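(* For any $3\le n\le\infty$, the set of kaleidoscopic colorings of $D_n$ is a dense $G_\delta$ subset of the space $\mathcal{C}$ of all colorings of $D_n$.
   Context: A dendrite is a locally connected continuum (non-empty compact connected metrizable space) containing no simple closed curve. Any two distinct points $x,y$ of a dendrite $X$ are joined by a unique arc $[x,y]$; put $(x,y)=[x,y]\setminus\{x,y\}$. For $x\in X$, $\widehat{x}=\pi_0(X\setminus\{x\})$ is the (at most countable) set of components of $X\setminus\{x\}$; $x$ is a branch point if $|\widehat{x}|\ge 3$, and $\mathrm{Br}(X)$ is the (at most countable) set of branch points. For $3\le n\le\infty$ ($\infty$ meaning countably infinite), the Ważewski dendrite $D_n$ is the dendrite, unique up to homeomorphism, which is not a single point, in which $|\widehat{x}|=n$ for every branch point $x$, and in which $(x,y)$ contains a branch point for all $x\ne y$. Write $[n]=\{m\in\mathbf{N}: m<n\}$ (so $[\infty]=\mathbf{N}\ni 0$). A coloring of $D_n$ is a map $c$ from the countable set $\widehat{D_n}=\bigsqcup_{x\in\mathrm{Br}(D_n)}\widehat{x}$ to $[n]$ whose restriction $c|_{\widehat{x}}$ is a bijection $\widehat{x}\to[n]$ for each $x\in \mathrm{Br}(D_n)$; for $y\ne x$, $c_x(y)$ denotes the color of the component of $D_n\setminus\{x\}$ containing $y$. The coloring is kaleidoscopic if for all distinct $x,y\in\mathrm{Br}(D_n)$ and all distinct $i,j\in[n]$ there is $z\in(x,y)\cap\mathrm{Br}(D_n)$ with $c_z(x)=i$ and $c_z(y)=j$. The set $\mathcal{C}\subseteq[n]^{\widehat{D_n}}$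 of all colorings is endowed with the subspace topology of the product topology, $[n]$ being discrete. *)

(* Defs.v *)
From HB Require Import structures.
From mathcomp Require Import all_boot all_order all_algebra.
From mathcomp Require Import all_classical all_reals all_analysis.

Set Implicit Arguments.
Unset Strict Implicit.
Unset Printing Implicit Defensive.

Import Order.TTheory GRing.Theory Num.Theory.
Import numFieldNormedType.Exports.

Local Open Scope classical_set_scope.
Local Open Scope ring_scope.
Local Open Scope card_scope.

(* [f] restricts to a homeomorphism of the subspace [A] onto the subspace [B],
   with inverse [g]; the values of [f] off [A] and of [g] off [B] are junk. *)
Definition homeo_on (T U : topologicalType) (A : set T) (B : set U)
    (f : T -> U) (g : U -> T) : Prop :=
  [/\ {within A, continuous f} /\ {within B, continuous g},
      set_fun A B f, set_fun B A g,
      {in A, cancel f g} & {in B, cancel g f}].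

Definition homeomorphic (T U : topologicalType) (A : set T) (B : set U) : Prop :=
  exists f : T -> U, exists g : U -> T, homeo_on A B f g.

Definition circle (R : realType) : set (R * R)%type :=
  [set p | p.1 ^+ 2 + p.2 ^+ 2 = 1].
Arguments circle R : clear implicits.

Definition metrizable (R : realType) (X : topologicalType) : Prop :=
  exists M : metricType R, homeomorphic [set: X] [set: M].

Definition locally_connected (X : topologicalType) : Prop :=
  forall (x : X) (U : set X), nbhs x U ->
    exists V : set X, [/\ open V, connected V, V x & V `<=` U].

Definition continuum (R : realType) (X : topologicalType) : Prop :=
  [/\ [set: X] !=set0, compact [set: X], connected [set: X] & metrizable R X].

Definition simple_closed_curve (R : realType) (X : topologicalType)
    (A : set X) : Prop :=
  homeomorphic (circle R) A.

Definition dendrite (R : realType) (X : topologicalType) : Prop :=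
  [/\ continuum R X, locally_connected X
    & ~ exists A : set X, simple_closed_curve R A].

Definition is_arc (R : realType) (X : topologicalType) (x y : X)
    (A : set X) : Prop :=
  exists f : R -> X, exists g : X -> R,
    [/\ homeo_on (`[0 : R, 1 : R] : set R) A f g, f 0 = x & f 1 = y].

(* The arc [x, y], as a definite description: in a dendrite, distinct points
   are the endpoints of exactly one arc (the default [set0] is junk). *)
Definition dendrite_arc (R : realType) (X : topologicalType) (x y : X) : set X :=
  xget set0 [set A | is_arc R x y A].

Definition open_arc (R : realType) (X : topologicalType) (x y : X) : set X :=
  dendrite_arc R x y `\` [set x; y].

Definition components_at (X : topologicalType) (x : X) : set (set X) :=
  connected_component (~` [set x]) @` (~` [set x]).

Definition branch (X : topologicalType) : set X :=
  [set x | `I_3 #<= components_at x].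
Arguments branch X : clear implicits.

(* An element n of {0, 1, 2, ...} U {oo} is encoded in [option nat], with
   [None] for oo; [colors n] is then [n] = {m in N | m < n}. *)
Definition colors (n : option nat) : set nat :=
  if n is Some k then `I_k else [set: nat].

Definition three_le (n : option nat) : Prop :=
  if n is Some k then (3 <= k)%N else True.

Definition wazewski_dendrite (R : realType) (n : option nat)
    (X : topologicalType) : Prop :=
  [/\ dendrite R X,
      exists x y : X, x <> y,
      forall x : X, branch X x -> components_at x #= colors n
    & forall x y : X, x <> y -> (open_arc R x y `&` branch X) !=set0].

(* The disjoint union of the sets [components_at x] over branch points [x]. *)
Definition branch_components (X : topologicalType) : Type :=
  {x : branch X & components_at (set_val x)}.

(* [n]^(branch_components X): the product topology, with [n] discrete. *)
Definition color_maps (n : option nat) (X : topologicalType) :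
    topologicalType :=
  prod_topology (fun _ : branch_components X => discrete_topology (colors n)).

Definition color (n : option nat) (X : topologicalType)
    (c : color_maps n X) (x : branch X) (C : components_at (set_val x)) :
    colors n :=
  c (existT _ x C).

Definition is_coloring (n : option nat) (X : topologicalType) :
    set (color_maps n X) :=
  [set c | forall x : branch X, bijective (@color n X c x)].
Arguments is_coloring n X : clear implicits.

(* [has_color c x y i] is c_x(y) = i: the component of X \ {x} which contains
   [y] has color [i]. *)
Definition has_color (n : option nat) (X : topologicalType)
    (c : color_maps n X) (x : branch X) (y : X) (i : colors n) : Prop :=
  exists C : components_at (set_val x), set_val C y /\ color c C = i.

Definition kaleidoscopic (R : realType) (n : option nat)
    (X : topologicalType) (c : color_maps n X) : Prop :=
  forall x y : branch X, x <> y -> forall i j : colors n, i <> j ->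
    exists z : branch X,
      [/\ open_arc R (set_val x) (set_val y) (set_val z),
          has_color c z (set_val x) i & has_color c z (set_val y) j].

(* A set coerces to the type of its elements, which carries the subspace
   topology. *)
Definition coloring (n : option nat) (X : topologicalType) : topologicalType :=
  is_coloring n X.

Definition kaleidoscopic_colorings (R : realType) (n : option nat)
    (X : topologicalType) : set (coloring n X) :=
  [set c | kaleidoscopic R (set_val c)].
Arguments kaleidoscopic_colorings R n X : clear implicits.

(* Main.v *)
Require Import Defs.
From mathcomp Require Import all_boot all_order all_algebra.
From mathcomp Require Import all_classical all_reals all_analysis borel_hierarchy.
From mathcomp Require Import ring lra.

(* Given distinct branch points x, y and distinct colors i, j, the colorings for
   which some z in (x, y) has c_z(x) = i and c_z(y) = j form an open set.  There
   are countably many branch points: a branch point is determined by three points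
   of a countable dense set which it separates pairwise.  Hence the G_delta part.
   For density, (x, y) contains infinitely many branch points, each separating x
   from y.  The countably many queries (x, y, i, j) are therefore answered at
   pairwise distinct branch points, away from finitely many prescribed ones, by
   permuting there the colors of a given coloring.

   The topological input is that a point z of an arc [x, y] separates x from y.
   Otherwise x and y lie in one component of the complement of z.  That component
   is open and connected, so by local connectedness and compactness it contains a
   path from x to y, a uniform limit of maps with smaller and smaller jumps.
   Erasing a maximal open set of loops makes all fibers of the path intervals, a
   Whitney-type function reparametrizes it as an injective path, and together with
   [x, y] it produces a simple closed curve. *)

Set Implicit Arguments.
Unset Strict Implicit.
Unset Printing Implicit Defensive.

Import Order.TTheory GRing.Theory Num.Theory.
Import numFieldNormedType.Exports.

Local Open Scope classical_set_scope.
Local Open Scope ring_scope.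

(** * Distances and connectedness *)

(** A metric compatible with the topology that [X] already carries, so that metric estimates apply
    to [X] itself. *)
Record distance (R : realType) (X : topologicalType) (d : X -> X -> R) : Prop :=
  Distance {
    dist_refl : forall x, d x x = 0;
    dist_sep : forall x y, d x y = 0 -> x = y;
    dist_sym : forall x y, d x y = d y x;
    dist_tri : forall y x z, d x z <= d x y + d y z;
    dist_nbhs : forall x (U : set X),
      nbhs x U <-> exists2 e, 0 < e & forall y, d x y < e -> U y }.

Lemma homeomorphic_distance (R : realType) (X : topologicalType)
    (M : metricType R) :
  homeomorphic [set: X] [set: M] -> exists d : X -> X -> R, distance d.
Proof.
move=> [f [g [[fc gc] _ _ fK gK]]].
have {}fc : continuous f by apply/continuous_subspace_setT.
have {}gc : continuous g by apply/continuous_subspace_setT.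
have {}fK x : g (f x) = x by apply: fK; rewrite inE.
have {}gK y : f (g y) = y by apply: gK; rewrite inE.
exists (fun x y => mdist (f x) (f y)); split.
- by move=> x; rewrite mdistxx.
- by move=> x y /mdist_positivity e; rewrite -(fK x) e fK.
- by move=> x y; rewrite metric_sym.
- by move=> y x z; exact: metric_triangle.
- move=> x U; split.
  + move=> xU; have : nbhs (f x) (g @^-1` U) by apply: (gc (f x)); rewrite fK.
    move=> /nbhs_ballP[e /= e0 eU]; exists e => // y xy.
    by rewrite -(fK y); apply: eU; rewrite ballEmdist.
  + move=> [e e0 eU].
    have : nbhs (f x) (ball (f x) e) by exact: nbhsx_ballx.
    move=> xe.
    apply: (@filterS _ (nbhs x) _ (f @^-1` (ball (f x) e)) U _ (fc x _ xe)) => y.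
    by rewrite /= ballEmdist; exact: eU.
Qed.

(** Local constancy makes both [P] and its negation relatively open in [W], so the nonempty part
    where [P] holds is clopen, hence all of [W]. *)
Lemma connected_ind (X : topologicalType) (W : set X) (P : X -> Prop) (p : X) :
    connected W -> W p -> P p ->
    (forall x, W x -> \forall y \near x, W y -> (P x <-> P y)) ->
  forall q, W q -> P q.
Proof.
move=> cW Wp Pp loc q Wq.
have key (Q : X -> Prop) : (forall x, W x -> \forall y \near x, W y -> (Q x <-> Q y)) ->
    exists2 C, open C & W `&` [set x | Q x] = W `&` C.
  move=> locQ.
  exists (\bigcup_(U in [set U | open U /\ W `&` U `<=` Q]) U).
    by apply: bigcup_open => U [].
  apply/seteqP; split => x [Wx].
  - move=> /= Qx; split => //.
    have : nbhs x [set y | W y -> Q x <-> Q y] := locQ _ Wx.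
    rewrite nbhsE /= => -[U [oU Ux] UQ].
    exists U => //; split => // y [Wy Uy].
    by apply/(UQ _ Uy Wy).
  - by move=> [U [_ UQ] Ux]; split=> //; exact: UQ.
suff E : W `&` [set x | P x] = W by move: Wq; rewrite -E => -[].
apply: cW.
- by exists p.
- exact: key.
- have [|C oC WC] := key (fun x => ~ P x).
    move=> x Wx; apply: filterS (loc x Wx) => y H Wy.
    by have := H Wy; tauto.
  exists (~` C); first exact: open_closedC.
  apply/seteqP; split => x [Wx].
  + move=> Px; split=> // Cx.
    suff: (W `&` [set x | ~ P x]) x by case.
    by rewrite WC.
  + move=> Cx; split=> //; apply: contrapT => nPx; apply: Cx.
    suff: (W `&` C) x by case.
    by rewrite -WC.
Qed.

Section Distance.
Variables (R : realType) (X : topologicalType) (d : X -> X -> R).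
Hypothesis dd : distance d.

Lemma dist_ge0 x y : 0 <= d x y.
Proof.
have := dist_tri dd y x x; rewrite (dist_refl dd) (dist_sym dd y x); lra.
Qed.

Lemma dist_ball_nbhs x e : 0 < e -> nbhs x [set y | d x y < e].
Proof. by move=> e0; apply/(dist_nbhs dd); exists e. Qed.

Lemma dist_hausdorff : hausdorff_space X.
Proof.
move=> x y cl; apply: (dist_sep dd); apply: contrapT => /eqP dxy.
have d0 : 0 < d x y by rewrite lt_neqAle eq_sym dxy dist_ge0.
have := cl _ _ (@dist_ball_nbhs x (d x y / 2) _) (@dist_ball_nbhs y (d x y / 2) _).
case; [lra|lra|] => z /= [].
have := dist_tri dd z x y; rewrite (dist_sym dd z y); lra.
Qed.

Lemma continuous_distP (f : R -> X) : continuous f <->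
  forall t e, 0 < e ->
    exists2 h, 0 < h & forall s, `|t - s| < h -> d (f t) (f s) < e.
Proof.
split=> [fc t e e0|H t U].
  have := fc t _ (dist_ball_nbhs (f t) e0).
  by move=> /nbhs_ballP[h /= h0 hU]; exists h => // s ts; apply: hU.
move=> /(dist_nbhs dd)[e e0 eU].
have [h h0 hs] := H t e e0.
by apply/nbhs_ballP; exists h => //= s /hs; exact: eU.
Qed.

(** A Lebesgue number argument: a connected neighborhood of [x] inside the ball of radius [e / 2]
    serves all close pairs near [x], and compactness yields one [h] for all [x]. *)
Lemma uniformly_locally_connected : compact [set: X] -> locally_connected X ->
  forall e, 0 < e -> exists2 h, 0 < h & forall p q, d p q < h ->
    exists W, [/\ connected W, W p, W q & forall w, W w -> d p w < e].
Proof.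
move=> cX lc e e0.
move: cX => /compact_near_coveringP /(_ _ (0^'+)
  (fun h p => forall q, d p q < h -> exists W,
     [/\ connected W, W p, W q & forall w, W w -> d p w < e])).
case=> [x _|h [/= h0]].
  have e2 : 0 < e / 2 by lra.
  have [V [oV cV Vx Ve]] := lc x _ (dist_ball_nbhs x e2).
  have /(dist_nbhs dd)[r r0 rV] : nbhs x V by exact: open_nbhs_nbhs.
  have r2 : 0 < r / 2 by lra.
  exists ([set y | d x y < r / 2], [set h | h < r / 2]).
    by split => /=; [exact: dist_ball_nbhs|exact: nbhs_right_lt].
  move=> [p h] [/= xp hr] q pq.
  exists V; split => //.
  - by apply: rV; lra.
  - by apply: rV; have := dist_tri dd p x q; lra.
  - move=> w /Ve /=; have /Ve/= : V p by apply: rV; lra.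
    by have := dist_tri dd x p w; rewrite (dist_sym dd p x); lra.
move=> H; have := H (h / 2).
rewrite /ball_ /= sub0r normrN gtr0_norm ?divr_gt0// => /(_ _ _)H'.
exists (h / 2); first by rewrite divr_gt0.
by move=> p q; apply: H' => //; rewrite ?ltr_pdivrMr ?ltr_pMr ?divr_gt0 ?ltr1n.
Qed.

End Distance.

(** * Paths in connected open sets *)

Section StepMaps.
Variables (R : realType) (X : topologicalType) (d : X -> X -> R).
Hypothesis dd : distance d.

(** An approximate path: [s] may be discontinuous, but it moves by less than [h] over parameter
    steps shorter than a uniform [k]. Being constant on each side of [[a, b]], such maps can be
    glued. *)
Definition step_map (h a b : R) (p q : X) (s : R -> X) : Prop :=
  [/\ forall t, t <= a -> s t = p, forall t, b <= t -> s t = q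
    & exists2 k, 0 < k & forall t u, t <= u -> u < t + k -> d (s t) (s u) < h].

Lemma step_map_cst h a p : 0 < h -> step_map h a a p p (fun=> p).
Proof.
by move=> h0; split => //; exists 1 => // *; rewrite (dist_refl dd).
Qed.

Lemma step_map_jump h a b p q : 0 < h -> a < b -> d p q < h ->
  step_map h a b p q (fun t => if t <= a then p else q).
Proof.
move=> h0 ab pq; split.
- by move=> t ->.
- by move=> t bt; rewrite leNgt (lt_le_trans ab bt).
- exists 1 => // t u tu _.
  have [ta|ta] := leP t a; have [ua|ua] := leP u a; rewrite ?(dist_refl dd) //.
  by exfalso; lra.
Qed.

(** Both maps equal [q] on the gap [[b, b']]. A short step across its midpoint sees the second map
    only where it is still [q]. *)
Lemma step_map_cat h a b b' c p q r s1 s2 : a <= b -> b < b' -> b' <= c ->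
  step_map h a b p q s1 -> step_map h b' c q r s2 ->
  step_map h a c p r (fun t => if t <= (b + b') / 2 then s1 t else s2 t).
Proof.
move=> ab bb' bc [s1a s1b [k1 k10 H1]] [s2a s2b [k2 k20 H2]]; split.
- by move=> t ta; rewrite ifT; [exact: s1a|lra].
- by move=> t ta; rewrite ifF; [exact: s2b|apply/negP; lra].
- exists (Num.min (Num.min k1 k2) ((b' - b) / 2)).
    by rewrite !lt_min k10 k20 /=; lra.
  move=> t u tu; rewrite -ltrBlDl !lt_min => /andP[/andP[u1 u2] u3].
  have [ta|ta] := leP t ((b + b') / 2); have [ua|ua] := leP u ((b + b') / 2).
  + by apply: H1 => //; lra.
  + rewrite (s2a u) -?(s1b u); [|lra|lra].
    by apply: H1 => //; lra.
  + by exfalso; lra.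
  + by apply: H2 => //; lra.
Qed.

(** Reachability from [p] is invariant under moves of length less than [h], so [connected_ind]
    applies. Quantifying over all intervals leaves room to append a jump. *)
Lemma connected_step_map (W : set X) p q h : connected W -> W p -> W q -> 0 < h ->
  forall a b, a < b -> exists2 s, step_map h a b p q s & forall t, W (s t).
Proof.
move=> cW Wp Wq h0; move: q Wq.
have ext q r : W r -> d q r < h ->
    (forall a b, a < b -> exists2 s, step_map h a b p q s & forall t, W (s t)) ->
    forall a b, a < b -> exists2 s, step_map h a b p r s & forall t, W (s t).
  move=> Wr qr H a b ab.
  have [|s1 S1 W1] := H a (a + (b - a) / 3); first lra.
  have Wq : W q by have [_ s1b _] := S1; rewrite -(s1b _ (lexx _)); exact: W1.
  have S2 := @step_map_jump h (a + (b - a) / 2) b q r h0 _ qr.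
  eexists; first by apply: (step_map_cat _ _ _ S1 (S2 _)); lra.
  by move=> t /=; do 2 case: ifP => // _; exact: W1.
apply: (connected_ind (p := p)) => //.
  move=> a b ab; exists (fun=> p) => //; split => //.
  by exists 1 => // *; rewrite (dist_refl dd).
move=> x Wx; apply: (filterS _ (dist_ball_nbhs dd x h0)) => y /= xy Wy.
split; first exact: ext.
by apply: ext => //; rewrite (dist_sym dd).
Qed.

(** Sample [s] with spacing [g < k] and join consecutive samples by finer step maps inside small
    connected sets. Between samples [s] strays by less than [h] and the new map by less than [e]. *)
Lemma step_map_refine h h' e a b p q s : 0 < h' -> 0 < e -> a < b ->
    (forall x y, d x y < h -> exists W,
       [/\ connected W, W x, W y & forall w, W w -> d x w < e]) ->
    step_map h a b p q s ->
  exists2 s', step_map h' a b p q s' & forall t, d (s t) (s' t) < h + e.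
Proof.
move=> h'0 e0 ab ulc [sa sb [k k0 sk]].
have h0 : 0 < h.
  by have := sk 0 0 (lexx _); rewrite (dist_refl dd) add0r; exact.
pose N := (Num.truncn ((b - a) / k)).+1; pose g := (b - a) / N%:R.
have N0 : (0 : R) < N%:R by rewrite ltr0n.
have g0 : 0 < g by rewrite divr_gt0 // subr_gt0.
have gk : g < k.
  rewrite /g ltr_pdivrMr // mulrC -ltr_pdivrMr //.
  by apply: truncnS_gt.
have main i : exists2 s', step_map h' a (a + i%:R * g) p (s (a + i%:R * g)) s'
    & forall t, t <= a + i%:R * g -> d (s t) (s' t) < h + e.
  elim: i => [|i [s1 S1 D1]].
    exists (fun=> p); first by rewrite mul0r addr0 sa //; exact: step_map_cst.
    by move=> t; rewrite mul0r addr0 => /sa ->; rewrite (dist_refl dd); lra.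
  set u := a + i%:R * g in S1 D1; set v := a + i.+1%:R * g.
  have vE : v = u + g by rewrite /v /u -natr1; ring.
  have uv : d (s u) (s v) < h by apply: sk; lra.
  have [W [cW Wu Wv We]] := ulc _ _ uv.
  (* Starting at [u + g / 2] leaves the gap that [step_map_cat] requires. *)
  have [|s2 S2 W2] := connected_step_map cW Wu Wv h'0 (a := u + g / 2) (b := v).
    by lra.
  have au : a <= u by rewrite /u lerDl mulr_ge0 // ltW.
  eexists; first by apply: (step_map_cat _ _ _ S1 S2); lra.
  move=> t tv /=; case: ifP => tm.
  - have [tu|tu] := leP t u; first exact: D1.
    have [_ s1u _] := S1; rewrite s1u; last by rewrite ltW.
    rewrite (dist_sym dd); have := sk u t; lra.
  - move: tm => /negbT; rewrite -ltNge => tm.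
    have := We _ (W2 t); have := sk u t; rewrite (dist_sym dd (s u) (s t)).
    by have := dist_tri dd (s u) (s t) (s2 t); lra.
have [s'] := main N.
have -> : a + N%:R * g = b by rewrite /g mulrC divfK ?gt_eqF //; lra.
rewrite sb // => S' D'; exists s' => // t.
have [tb|tb] := leP t b; first exact: D'.
have [_ s'b _] := S'.
by rewrite sb ?s'b ?(dist_refl dd); lra.
Qed.

End StepMaps.

Section LocalPaths.
Variables (R : realType) (X : topologicalType) (d : X -> X -> R).
Hypothesis dd : distance d.
Hypothesis cX : compact [set: X].

Lemma exists_half_pow_lt (c x : R) : 0 < x -> exists k : nat, c / 2 ^+ k < x.
Proof.
move=> x0; exists (Num.truncn (c / x)).+1.
rewrite ltr_pdivrMr ?exprn_gt0 // mulrC -ltr_pdivrMr //.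
apply: (lt_le_trans (truncnS_gt _)).
by rewrite -natrX ler_nat ltnW // ltn_expl.
Qed.

Lemma dist_telescope (e : R) (x : nat -> X) :
    (forall k, d (x k) (x k.+1) <= e / 2 ^+ k) ->
  forall k m, (k <= m)%N -> d (x k) (x m) <= 2 * e / 2 ^+ k - 2 * e / 2 ^+ m.
Proof.
move=> H k m /subnK <-; elim: (m - k)%N => [|i IH].
  by rewrite add0n (dist_refl dd) subrr.
rewrite addSn; have := dist_tri dd (x (i + k)%N) (x k) (x (i + k).+1).
have := H (i + k)%N; rewrite exprS.
have p0 : (2 : R) ^+ (i + k) != 0 by rewrite expf_neq0.
have -> : 2 * e / (2 * 2 ^+ (i + k)) = e / 2 ^+ (i + k) by field.
by move: IH; rewrite -[2 * e / 2 ^+ (i + k)]mulrA; lra.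
Qed.

(** Completeness comes from compactness: a cluster point is the limit, and the geometric tail gives
    the rate. *)
Lemma dist_cauchy (e : R) (x : nat -> X) : 0 < e ->
    (forall k, d (x k) (x k.+1) <= e / 2 ^+ k) ->
  exists l, forall k, d (x k) l <= 2 * e / 2 ^+ k.
Proof.
move=> e0 /dist_telescope H.
have [l [_ cl]] := cX (F := (x @ \oo)) _ filterT.
exists l => k; apply/ler_addgt0Pr => c c0.
have xk : (x @ \oo) [set y | exists2 m, (k <= m)%N & y = x m].
  by exists k => // m /= km; exists m.
have [_ [[m km ->] /= lm]] := cl _ _ xk (dist_ball_nbhs dd l c0).
have := dist_tri dd (x m) (x k) l; rewrite (dist_sym dd (x m) l).
have := H k m km.
have : 0 <= 2 * e / 2 ^+ m by rewrite divr_ge0 ?exprn_ge0 // mulr_ge0 // ltW.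
lra.
Qed.

(** Repeated refinement gives step maps whose successive distances are summable, hence a uniform
    limit; it is continuous because the jump bounds [h k] tend to 0. *)
Lemma local_paths : locally_connected X -> forall e, 0 < e ->
  exists2 h, 0 < h & forall p q, d p q < h -> exists g : R -> X,
    [/\ continuous g, g 0 = p, g 1 = q & forall t, d p (g t) < e].
Proof.
(* The first step map stays within [e] of [p] and the limit within [4 * e] of that map, so [6 * e]
   suffices. *)
move=> lc e' e'0; pose e := e' / 6; have e0 : 0 < e by rewrite /e; lra.
have ek0 k : 0 < e / 2 ^+ k by rewrite divr_gt0 ?exprn_gt0.
have /choice[h0 hP0] k : exists h, 0 < h /\ forall p q, d p q < h -> exists W,
    [/\ connected W, W p, W q & forall w, W w -> d p w < e / 2 ^+ k].
  by have [h h0 H] := uniformly_locally_connected dd cX lc (ek0 k); exists h.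
pose h k := Num.min (h0 k) (e / 2 ^+ k).
have hgt0 k : 0 < h k by rewrite lt_min (hP0 k).1 ek0.
have hP k p q : d p q < h k -> exists W,
    [/\ connected W, W p, W q & forall w, W w -> d p w < e / 2 ^+ k].
  by rewrite lt_min => /andP[pq _]; exact: (hP0 k).2.
have he k : h k <= e / 2 ^+ k by rewrite ge_min lexx orbT.
exists (h 0%N) => // p q pq.
have [W [cW Wp Wq We]] := hP _ _ _ pq.
have [s0 S0 W0] := connected_step_map dd cW Wp Wq (hgt0 0%N) (@ltr01 R).
(* The refinement is a total function with a conditional property, so that the iterates are defined
   before their invariant is proved. *)
have /choice[nxt nxtP] : forall ks : nat * (R -> X), exists s',
    step_map d (h ks.1) 0 1 p q ks.2 -> step_map d (h ks.1.+1) 0 1 p q s' /\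
    forall t, d (ks.2 t) (s' t) < 2 * e / 2 ^+ ks.1.
  move=> [k s] /=; have [S|nS] := pselect (step_map d (h k) 0 1 p q s); last first.
    by exists s => /nS.
  have [s' S' D] := step_map_refine dd (hgt0 k.+1) (ek0 k) (@ltr01 R) (hP k) S.
  exists s' => _; split=> // t; apply: (lt_le_trans (D t)).
  by have := he k; rewrite -mulrA; lra.
pose s := fix s k := if k is k'.+1 then nxt (k', s k') else s0.
have sP k : step_map d (h k) 0 1 p q (s k).
  by elim: k => //= k IH; exact: (nxtP (k, s k) IH).1.
have sD k t : d (s k t) (s k.+1 t) <= 2 * e / 2 ^+ k.
  by apply: ltW; exact: (nxtP (k, s k) (sP k)).2.
have e20 : 0 < 2 * e by lra.
have /choice[g gP] t : exists l, forall k, d (s k t) l <= 2 * (2 * e) / 2 ^+ k.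
  by apply: (dist_cauchy e20) => k; exact: sD.
have gval t x : (forall k, s k t = x) -> g t = x.
  move=> sx; apply: (dist_sep dd); apply: contrapT => /eqP xg.
  have dx : 0 < d (g t) x by rewrite lt_neqAle eq_sym xg dist_ge0.
  have [k] := exists_half_pow_lt (2 * (2 * e)) dx.
  by have := gP t k; rewrite sx (dist_sym dd x); lra.
exists g; split.
- apply/(continuous_distP dd) => t c c0.
  (* The factor 9 collects two distances to the limit, each at most [4 * e / 2 ^ k], and one jump
     below [e / 2 ^ k]. *)
  have [k hk] := exists_half_pow_lt (9 * e) c0.
  have [_ _ [r r0 Hr]] := sP k.
  exists r => // u tu.
  have su : d (s k t) (s k u) < h k.
    have [le_tu|lt_ut] := leP t u.
      by apply: Hr => //; move: tu; rewrite distrC ger0_norm; lra.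
    rewrite (dist_sym dd); apply: Hr; first exact: ltW.
    by move: tu; rewrite gtr0_norm; lra.
  have := gP t k; have := gP u k; rewrite (dist_sym dd (s k t) (g t)).
  have := dist_tri dd (s k t) (g t) (g u); have := dist_tri dd (s k u) (s k t) (g u).
  have := he k; move: hk; rewrite -!mulrA; lra.
- by apply: gval => k; have [H _ _] := sP k; exact: H.
- by apply: gval => k; have [_ H _] := sP k; exact: H.
- move=> t; have := gP t 0%N; have := We _ (W0 t).
  have := dist_tri dd (s0 t) p (g t); rewrite /= expr0 !divr1 /e; lra.
Qed.

Lemma path_cat (O : set X) (g1 g2 : R -> X) :
    continuous g1 -> continuous g2 -> g1 1 = g2 0 ->
    (forall t, O (g1 t)) -> (forall t, O (g2 t)) ->
  exists g : R -> X,
    [/\ continuous g, g 0 = g1 0, g 1 = g2 1 & forall t, O (g t)].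
Proof.
move=> /(continuous_distP dd) c1 /(continuous_distP dd) c2 e12 O1 O2.
exists (fun t => if t <= 1 / 2 then g1 (2 * t) else g2 (2 * t - 1)); split.
- apply/(continuous_distP dd) => t e e0.
  have [h1 h10 H1] := c1 (2 * t) e e0.
  have [h2 h20 H2] := c2 (2 * t - 1) e e0.
  have Nlt (x y z : R) : (`|x - y| < z) = (x - y < z) && (y - x < z).
    by rewrite ltr_norml -(opprB x y) ltrNl andbC.
  have [t12|t12|t12] := ltgtP t (1 / 2).
  + exists (Num.min (h1 / 2) (1 / 2 - t)); first by rewrite lt_min; lra.
    move=> s; rewrite lt_min !Nlt => /andP[/andP[a b] /andP[a' b']].
    by rewrite ifT; [apply: H1; rewrite Nlt; lra|lra].
  + exists (Num.min (h2 / 2) (t - 1 / 2)); first by rewrite lt_min; lra.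
    move=> s; rewrite lt_min !Nlt => /andP[/andP[a b] /andP[a' b']].
    by rewrite ifF; [apply: H2; rewrite Nlt; lra|apply/negP; lra].
  + exists (Num.min (h1 / 2) (h2 / 2)); first by rewrite lt_min; lra.
    move=> s; rewrite lt_min !Nlt => /andP[/andP[a b] /andP[a' b']].
    case: ifP => s12; first by apply: H1; rewrite Nlt; lra.
    have -> : g1 (2 * t) = g2 (2 * t - 1).
      rewrite t12; have -> : 2 * (1 / 2) = 1 :> R by field.
      by rewrite e12 subrr.
    by apply: H2; rewrite Nlt; lra.
- by rewrite mulr0 ifT //; lra.
- by rewrite ifF; [congr g2; lra|apply/negP; lra].
- by move=> t; case: ifP.
Qed.

(** Reachability by paths in [O] is locally constant along [W], because nearby points are joined by
    short paths. These may leave [W] but not the open set [O]. *)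
Lemma connected_path (O W : set X) p q : locally_connected X ->
    open O -> connected W -> W `<=` O -> W p -> W q ->
  exists g : R -> X, [/\ continuous g, g 0 = p, g 1 = q & forall t, O (g t)].
Proof.
move=> lc oO cW WO Wp; move: q.
apply: (connected_ind (p := p)) => //.
  exists (fun=> p); split => //; first exact: cst_continuous.
  by move=> _; exact: WO.
move=> x Wx.
have /(dist_nbhs dd)[e e0 eO] : nbhs x O by apply: open_nbhs_nbhs; split; auto.
have e20 : 0 < e / 2 by lra.
have [h h0 H] := local_paths lc e20.
have r0 : 0 < Num.min h (e / 2) by rewrite lt_min h0.
apply: (filterS _ (dist_ball_nbhs dd x r0)) => y /=.
rewrite lt_min => /andP[xy xye] Wy.
have step u v : d x u < e / 2 -> d u v < h ->
    (exists g : R -> X, [/\ continuous g, g 0 = p, g 1 = u & forall t, O (g t)]) ->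
    exists g : R -> X, [/\ continuous g, g 0 = p, g 1 = v & forall t, O (g t)].
  move=> xu uv [g1 [c1 g10 g11 O1]].
  have [g2 [c2 g20 g21 g2e]] := H _ _ uv.
  have O2 t : O (g2 t).
    by apply: eO; have := g2e t; have := dist_tri dd u x (g2 t); lra.
  have [|g [cg g0 g1' Og]] := path_cat c1 c2 _ O1 O2; first by rewrite g11 g20.
  by exists g; split => //; [rewrite g0|rewrite g1'].
split; apply: step => //; last by rewrite (dist_sym dd).
by rewrite (dist_refl dd); lra.
Qed.

End LocalPaths.

(** * Loop erasure *)

(** For [t] in [U] this gives the left endpoint of the component of [U] around [t]; otherwise it
    gives [t] itself. *)
Lemma last_out (R : realType) (U : set R) t : open U ->
    (exists2 s, s <= t & ~ U s) ->
  exists l, [/\ l <= t, ~ U l & forall s, l < s -> s <= t -> U s].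
Proof.
move=> oU [s0 s0t nUs0]; pose S := [set s | s <= t /\ ~ U s].
have supS : has_sup S by split; [exists s0|exists t => s []].
exists (sup S); split.
- by apply: ge_sup => [|s []//]; exists s0.
- move=> Us; have : nbhs (sup S) U by exact: open_nbhs_nbhs.
  move=> /nbhs_ballP[h /= h0 hU].
  have [s [st nUs] hs] := sup_adherent h0 supS.
  apply: (nUs); apply: hU; rewrite /ball /= ger0_norm.
    by rewrite ltrBlDr -ltrBlDl.
  by rewrite subr_ge0; apply: ub_le_sup; [exists t => ? []|split].
- move=> s ls st; apply: contrapT => nUs; move: ls; apply/negP; rewrite -leNgt.
  by apply: ub_le_sup; [exists t => ? []|split].
Qed.

Lemma first_out (R : realType) (U : set R) t : open U ->
    (exists2 s, t <= s & ~ U s) ->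
  exists r, [/\ t <= r, ~ U r & forall s, s < r -> t <= s -> U s].
Proof.
move=> oU [s0 s0t nUs0].
have oV : open (-%R @^-1` U) by apply: open_comp => // x _; exact: oppr_continuous.
have [|l [lt nUl lU]] := last_out (t := - t) oV.
  by exists (- s0); rewrite ?lerN2 //= opprK.
exists (- l); split=> //; first by rewrite lerNr.
by move=> s sl ts; rewrite -(opprK s); apply: lU; [rewrite ltrNr|rewrite lerN2].
Qed.

(** Compactness for a chain, by [connected_ind] on the right end: a member covering [[a, t]] and a
    member around [t] are comparable, so the larger one reaches past [t]. *)
Lemma segment_sub_chain (R : realType) (F : set (set R)) (a b : R) : a <= b ->
    total_on F subset -> F `<=` open ->
    (forall t, a <= t <= b -> (\bigcup_(U in F) U) t) ->
  exists2 U, F U & forall t, a <= t <= b -> U t.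
Proof.
move=> ab tF oF cov.
suff H : forall t, (`[a, b]%classic : set R) t ->
    exists2 U, F U & forall s, a <= s <= t -> U s.
  by have [|U FU Us] := H b; [rewrite /= in_itv /= ab lexx|exists U].
apply: (connected_ind (p := a)).
- exact: segment_connected.
- by rewrite /= in_itv /= ab lexx.
- have [|U FU Ua] := cov a; first by rewrite ab lexx.
  by exists U => // s; rewrite -eq_le => /eqP <-.
- move=> t; rewrite /= in_itv /= => /cov[V FV Vt].
  have : nbhs t V by apply: open_nbhs_nbhs; split => //; exact: oF.
  move=> /nbhs_ballP[h /= h0 hV].
  apply: (filterS _ (nbhsx_ballx t h h0)) => u tu _.
  have step x y : ball t h x -> ball t h y ->
      (exists2 U, F U & forall s, a <= s <= x -> U s) ->
      (exists2 U, F U & forall s, a <= s <= y -> U s).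
    move=> tx ty [U FU Ux].
    have [W [FW UW VW]] : exists W, [/\ F W, U `<=` W & V `<=` W].
      by have [UV|VU] := tF _ _ FU FV; [exists V|exists U]; split=> // x.
    exists W => // s /andP[as_ sy]; have [sx|xs] := leP s x.
      by apply: UW; apply: Ux; rewrite as_.
    apply: VW; apply: hV; move: tx ty; rewrite /ball /= !ltr_norml.
    by move=> /andP[? ?] /andP[? ?]; apply/andP; split; lra.
  have tt : ball t h t by exact: ballxx.
  by split; apply: step.
Qed.

Section LoopErasure.
Variables (R : realType) (X : topologicalType) (d : X -> X -> R).
Hypothesis dd : distance d.

(* The connected components of [U] are the loops to be removed from [g]. *)
Definition loop_set (g : R -> X) (U : set R) : Prop :=
  [/\ open U, forall t, U t -> 0 < t < 1
    & forall a b, a < b -> ~ U a -> ~ U b ->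
        (forall t, a < t < b -> U t) -> g a = g b].

(** Slightly shrunk, a gap []a, b[] of the union is covered by a single member, whose component has
    endpoints near [a] and [b] with equal images. Continuity gives [g a = g b]. *)
Lemma loop_set_bigcup g (F : set (set R)) : continuous g ->
    F `<=` loop_set g -> total_on F subset -> loop_set g (\bigcup_(U in F) U).
Proof.
move=> /(continuous_distP dd) cg FP tF; split.
- by apply: bigcup_open => U /FP[].
- by move=> t [U /FP[_ H _]]; exact: H.
move=> a b ab na nb cov; apply: (dist_sep dd); apply: contrapT => /eqP dab.
have e0 : 0 < d (g a) (g b) / 2.
  by rewrite divr_gt0 // lt_neqAle eq_sym dab dist_ge0.
have [h1 h10 H1] := cg a _ e0; have [h2 h20 H2] := cg b _ e0.
pose c := Num.min (Num.min h1 h2) (b - a) / 3.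
have [c0 c1 c2 c3] : [/\ 0 < c, c < h1, c < h2 & 3 * c <= b - a].
  have := ge_min (Num.min h1 h2) (Num.min h1 h2) (b - a).
  have := ge_min (b - a) (Num.min h1 h2) (b - a).
  have := ge_min h1 h1 h2; have := ge_min h2 h1 h2; rewrite !lexx ?orbT /=.
  have : 0 < Num.min (Num.min h1 h2) (b - a).
    by rewrite !lt_min h10 h20 subr_gt0.
  by rewrite /c; split; lra.
have [|||t tt|U FU Us] := @segment_sub_chain R F (a + c) (b - c).
- lra.
- exact: tF.
- by move=> U /FP[].
- by apply: cov; lra.
have [oU _ gapU] := FP _ FU.
have nUa : ~ U a by move=> Ua; apply: na; exists U.
have nUb : ~ U b by move=> Ub; apply: nb; exists U.
have [|l [lac nUl lU]] := last_out (t := a + c) oU.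
  by exists a => //; lra.
have [|r [rbc nUr rU]] := first_out (t := b - c) oU.
  by exists b => //; lra.
have al : a <= l by rewrite leNgt; apply/negP => la; apply: nUa; apply: lU; lra.
have rb : r <= b by rewrite leNgt; apply/negP => rb; apply: nUb; apply: rU; lra.
have glr : g l = g r.
  apply: gapU => //; first lra.
  move=> t /andP[lt tr]; have [tac|tac] := leP t (a + c); first exact: lU.
  have [tbc|tbc] := leP (b - c) t; first exact: rU.
  by apply: Us; lra.
have : d (g a) (g l) < d (g a) (g b) / 2 by apply: H1; rewrite ltr_norml; lra.
have : d (g b) (g r) < d (g a) (g b) / 2 by apply: H2; rewrite ltr_norml; lra.
have := dist_tri dd (g l) (g a) (g b); rewrite glr (dist_sym dd (g b) (g r)); lra.
Qed.

(** Freeze [g] on each component of a maximal loop set [U] at its value at the left endpoint. A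
    remaining coincidence of values would allow [U] to be enlarged. *)
Lemma loop_erase (g : R -> X) : continuous g -> exists f : R -> X,
  [/\ continuous f, f 0 = g 0, f 1 = g 1, forall t, exists s, f t = g s
    & forall s t, 0 <= s -> s <= t -> t <= 1 -> f s = f t ->
        forall u, s <= u -> u <= t -> f u = f s].
Proof.
move=> cg.
have [U [[oU U01 gapU] maxU]] :
    exists U, loop_set g U /\ forall V, U `<` V -> ~ loop_set g V.
  by apply: Zorn_bigcup => F FP tF; exact: loop_set_bigcup.
have nU0 t : t <= 0 -> ~ U t by move=> t0 /U01; lra.
have nU1 t : 1 <= t -> ~ U t by move=> t0 /U01; lra.
have /choice[l lP] t : exists l,
    [/\ l <= t, ~ U l & forall s, l < s -> s <= t -> U s].
  apply: last_out => //; exists (Num.min t 0); first by rewrite ge_min lexx.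
  by apply: nU0; rewrite ge_min lexx orbT.
have /choice[r rP] t : exists r,
    [/\ t <= r, ~ U r & forall s, s < r -> t <= s -> U s].
  apply: first_out => //; exists (Num.max t 1); first by rewrite le_max lexx.
  by apply: nU1; rewrite le_max lexx orbT.
have le_l a t : ~ U a -> a <= t -> a <= l t.
  move=> na at_; rewrite leNgt; apply/negP => la; apply: na.
  by have [_ _] := lP t; apply.
have le_r a t : ~ U a -> t <= a -> r t <= a.
  move=> na at_; rewrite leNgt; apply/negP => la; apply: na.
  by have [_ _] := rP t; apply.
have lid t : ~ U t -> l t = t.
  move=> nt; apply: le_anti; rewrite (le_l t t) // andbT.
  by have [] := lP t.
have rid t : ~ U t -> r t = t.
  move=> nt; apply: le_anti; rewrite (le_r t t) //=.
  by have [] := rP t.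
have lr t : g (l t) = g (r t).
  have [Ut|nUt] := pselect (U t); last by rewrite lid ?rid.
  have [lt nl lU] := lP t; have [tr nr rU] := rP t.
  apply: gapU => //.
    rewrite (le_lt_trans lt) // lt_neqAle tr andbT.
    by apply/eqP => e; apply: nr; rewrite -e.
  move=> s /andP[ls sr]; have [st|ts] := leP s t; first exact: lU.
  by apply: rU => //; exact: ltW.
have lcst s t : s <= t -> (forall u, s < u -> u <= t -> U u) -> l s = l t.
  move=> st sU; have [ls nl lU] := lP s; apply: le_anti.
  rewrite (le_l (l s) t) ?(le_trans ls) //=.
  have [lt' nl' lU'] := lP t; apply: le_l => //.
  by rewrite leNgt; apply/negP => sl; apply: nl'; exact: sU.
exists (g \o l); split.
- apply/(continuous_distP dd) => t e e0 /=.
  have [Ut|nUt] := pselect (U t).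
    have : nbhs t U by exact: open_nbhs_nbhs.
    move=> /nbhs_ballP[h /= h0 hU]; exists h => // s ts.
    suff -> : l t = l s by rewrite (dist_refl dd).
    move: ts; rewrite ltr_norml => /andP[ts st].
    have [le_ts|lt_st] := leP t s.
      apply: lcst => // u tu us; apply: hU.
      by rewrite /ball /= ltr_norml; lra.
    apply/esym/lcst; first exact: ltW.
    by move=> u tu us; apply: hU; rewrite /ball /= ltr_norml; lra.
  have [h h0 H] := (iffLR (continuous_distP dd g) cg) t e e0.
  exists h => // s; rewrite (lid _ nUt) ltr_norml => /andP[st ts].
  have [le_ts|lt_st] := leP t s.
    apply: H; rewrite ltr_norml; have := le_l t s nUt le_ts.
    by have [? _ _] := lP s; lra.
  (* For [s < t] the left endpoint [l s] may be far from [t], but [r s] lies between [s] and [t] and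
     has the same image. *)
  rewrite lr; apply: H; rewrite ltr_norml; have := le_r t s nUt (ltW lt_st).
  by have [? _ _] := rP s; lra.
- by rewrite /= lid //; exact: nU0.
- by rewrite /= lid //; exact: nU1.
- by move=> t; exists (l t).
- move=> s t s0 st t1 /= glst u su ut.
  have [ls nls lsU] := lP s; have [lt nlt ltU] := lP t.
  have ls0 : 0 <= l s by apply: le_l => //; exact: nU0.
  have lst : l s <= l t by apply: le_l => //; lra.
  have lsu : l s <= l u by apply: le_l => //; lra.
  have lut : l u <= l t by apply: le_l; [case: (lP u)|case: (lP u) => ? _ _; lra].
  move: lst; rewrite le_eqVlt => /orP[/eqP e|lst].
    by congr g; apply: le_anti; rewrite lsu andbT e.
  (* Since [g] agrees at [l s] and [l t], adding the interval between them to [U] gives a loop set,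
     so by maximality it is already in [U]. *)
  have merge v : l s < v -> v < l t -> U v.
    move=> sv vt; apply: contrapT => nUv.
    pose V := U `|` [set x | l s < x < l t].
    apply: (maxU V).
      split; first by move=> x; left.
      by move=> VU; apply: nUv; apply: VU; right; rewrite /= sv.
    split.
    - apply: openU => //; rewrite (_ : [set x | _] = `](l s), (l t)[%classic).
        exact: itv_open.
      by apply/seteqP; split => x /=; rewrite in_itv.
    - by move=> x [/U01//|/=]; lra.
    - move=> a b ab na nb abV.
      have nsl : ~ V (l s) by move=> [//|/=]; rewrite ltxx.
      have ntl : ~ V (l t) by move=> [//|/=]; rewrite ltxx andbF.
      (* A gap of [V] meeting the added interval equals it, because [l s] and [l t] are outside [V];
         any other gap is a gap of [U]. *)
      have [[x [ax sx]]|nx] := pselect (exists x, a < x < b /\ l s < x < l t).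
        have sa : ~ (a < l s < b) by move=> /abV.
        have ta : ~ (a < l t < b) by move=> /abV.
        have as_ : ~ (l s < a < l t) by move=> h; apply: na; right.
        have bs_ : ~ (l s < b < l t) by move=> h; apply: nb; right.
        have -> : a = l s.
          apply: contrapT => /eqP; rewrite neq_lt => /orP[h|h].
            by apply: sa; lra.
          by apply: as_; lra.
        have -> // : b = l t.
        apply: contrapT => /eqP; rewrite neq_lt => /orP[h|h].
          by apply: bs_; lra.
        by apply: ta; lra.
      apply: gapU => //.
      - by move=> h; apply: na; left.
      - by move=> h; apply: nb; left.
      - move=> x axb; have [//|sx] := abV x axb.
        by exfalso; apply: nx; exists x.
  have [_ nlu _] := lP u.
  have [e|nes] := eqVneq (l u) (l s); first by rewrite e.
  have [e|net] := eqVneq (l u) (l t); first by rewrite e.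
  exfalso; apply: nlu; apply: merge; rewrite lt_neqAle.
    by rewrite eq_sym nes.
  by rewrite net.
Qed.

End LoopErasure.

(** * Simple closed curves *)

Lemma within_comp (T U V : topologicalType) (A : set T) (B : set U)
    (f : T -> U) (g : U -> V) :
  {within A, continuous f} -> {within B, continuous g} -> set_fun A B f ->
  {within A, continuous (g \o f)}.
Proof.
move=> cf cg AB; apply/continuous_closedP => C cC.
move/continuous_closedP: cg => /(_ C cC)/closed_subspaceP[D cD DB].
move/continuous_closedP: cf => /(_ D cD)/closed_subspaceP[E cE EA].
apply/closed_subspaceP; exists E => //; rewrite EA.
apply/seteqP; split => x [/= fx Ax]; split => //.
- by have : (D `&` B) (f x) by [split; [|exact: AB]]; rewrite DB => -[].
- by have : (g @^-1` C `&` B) (f x) by [split; [|exact: AB]]; rewrite -DB => -[].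
Qed.

(* A continuous map on a compact set is a quotient map onto its image. *)
Lemma compact_factor (T Y Z : topologicalType) (K : set T) (t0 : T)
    (f : T -> Y) (phi : T -> Z) :
    compact K -> hausdorff_space Z ->
    {within K, continuous f} -> {within K, continuous phi} ->
    (forall s t, K s -> K t -> phi s = phi t -> f s = f t) ->
  exists h, {within phi @` K, continuous h} /\ forall s, K s -> h (phi s) = f s.
Proof.
move=> cK hZ cf cphi fib.
have /choice[g gP] z : exists t, (phi @` K) z -> K t /\ phi t = z.
  have [[t Kt <-]|nz] := pselect ((phi @` K) z); first by exists t.
  by exists t0 => /nz.
have hP s : K s -> f (g (phi s)) = f s.
  by move=> Ks; have [|Kg e] := gP (phi s); [exists s|exact: fib].
exists (f \o g); split => //.
apply/continuous_closedP => C cC.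
move/continuous_closedP: cf => /(_ C cC)/closed_subspaceP[D cD DK].
apply/closed_subspaceP; exists (phi @` (K `&` D)).
  apply: compact_closed => //; apply: continuous_compact.
    by apply: (continuous_subspaceW _ cphi) => x [].
  exact: compact_closedI.
apply/seteqP; split => z.
- move=> [[s [Ks Ds] <-] _]; split; last by exists s.
  change (C (f (g (phi s)))); rewrite hP //.
  by have : (D `&` K) s by []; rewrite DK => -[].
- move=> [/= Cz Kz]; split => //; have [Kg e] := gP z Kz.
  exists (g z) => //; split => //.
  by have : (f @^-1` C `&` K) (g z) by []; rewrite -DK => -[].
Qed.

(** Both images are quotients of [K] with the same fibers, so each map factors through the other. *)
Lemma compact_quotient_homeomorphic (T Y Z : topologicalType) (K : set T) (t0 : T)
    (f : T -> Y) (phi : T -> Z) :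
    compact K -> hausdorff_space Y -> hausdorff_space Z ->
    {within K, continuous f} -> {within K, continuous phi} ->
    (forall s t, K s -> K t -> phi s = phi t <-> f s = f t) ->
  homeomorphic (phi @` K) (f @` K).
Proof.
move=> cK hY hZ cf cphi fib.
have [h [ch hP]] := compact_factor t0 cK hZ cf cphi
  (fun s t Ks Kt => iffLR (fib s t Ks Kt)).
have [h' [ch' hP']] := compact_factor t0 cK hY cphi cf
  (fun s t Ks Kt => iffRL (fib s t Ks Kt)).
exists h, h'; split.
- by [].
- by move=> _ [s Ks <-]; exists s => //; rewrite hP.
- by move=> _ [s Ks <-]; exists s => //; rewrite hP'.
- by move=> z; rewrite inE => -[s Ks <-]; rewrite hP // hP'.
- by move=> z; rewrite inE => -[s Ks <-]; rewrite hP' // hP.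
Qed.

Section Clamp.
Variables (R : realType) (a b : R).
Hypothesis ab : a <= b.

(** The retraction of the line onto [[a, b]]; it turns continuity within the segment into continuity
    everywhere. *)
Definition clamp (t : R) : R := if t <= a then a else if b <= t then b else t.

Lemma clamp_itv t : a <= clamp t <= b.
Proof. by rewrite /clamp; case: (leP t a) => ?; case: (leP b t) => ? /=; move: ab; lra. Qed.

Lemma clamp_id t : a <= t <= b -> clamp t = t.
Proof. by rewrite /clamp; case: (leP t a) => ?; case: (leP b t) => ? /=; move: ab; lra. Qed.

Lemma clamp_le s t : s <= t -> clamp s <= clamp t.
Proof.
by rewrite /clamp; case: (leP s a) => ?; case: (leP b s) => ?;
  case: (leP t a) => ?; case: (leP b t) => ? /=; move: ab; lra.
Qed.

Lemma clamp_continuous : continuous clamp.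
Proof.
move=> t; apply/cvgrPdist_lt => e e0; apply/nbhs_ballP; exists e => //= s.
rewrite /ball /= !ltr_norml /clamp.
by case: (leP s a) => ?; case: (leP b s) => ?;
  case: (leP t a) => ?; case: (leP b t) => ? /=; move: ab; lra.
Qed.

Lemma continuous_clamp (X : topologicalType) (f : R -> X) :
  {within `[a, b], continuous f} -> continuous (f \o clamp).
Proof.
move=> cf; apply/continuous_subspace_setT.
apply: (within_comp (B := `[a, b]%classic)) => //.
  by apply: continuous_subspaceT; exact: clamp_continuous.
by move=> t _; rewrite /= in_itv /= clamp_itv.
Qed.

End Clamp.

Lemma continuous_pair (T U V : topologicalType) (f : T -> U) (g : T -> V) :
  continuous f -> continuous g -> continuous (fun t => (f t, g t)).
Proof. by move=> cf cg t; exact: (cvg_pair (cf t) (cg t)). Qed.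

Section Circle.
Variables (R : realType) (X : topologicalType).
Hypothesis hX : hausdorff_space X.

Definition upper_circle : set (R * R)%type :=
  (fun t => (t, Num.sqrt (1 - t ^+ 2))) @` `[-1, 1].
Definition lower_circle : set (R * R)%type :=
  (fun t => (t, - Num.sqrt (1 - t ^+ 2))) @` `[-1, 1].

Lemma sqrt_circle_continuous : continuous (fun t : R => Num.sqrt (1 - t ^+ 2)).
Proof.
move=> t; apply: continuous_comp; last exact: sqrt_continuous.
apply: continuousB; first exact: cst_continuous.
exact: exprn_continuous.
Qed.

Lemma upper_circle_compact : compact upper_circle.
Proof.
apply: continuous_compact; last exact: segment_compact.
apply/continuous_subspaceT/continuous_pair; first by move=> t; exact: cvg_id.
exact: sqrt_circle_continuous.
Qed.

Lemma lower_circle_compact : compact lower_circle.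
Proof.
apply: continuous_compact; last exact: segment_compact.
apply/continuous_subspaceT/continuous_pair => t; first exact: cvg_id.
by apply: cvgN; exact: sqrt_circle_continuous.
Qed.

Lemma R2_hausdorff : hausdorff_space (R * R)%type.
Proof. exact: (@norm_hausdorff R (R * R)%type). Qed.

Lemma upper_circleE p : upper_circle p <-> circle R p /\ 0 <= p.2.
Proof.
case: p => x y; rewrite /circle /=; split.
  move=> [t]; rewrite /= in_itv /= => /andP[t1 t2] [<- <-].
  by rewrite sqrtr_ge0 sqr_sqrtr; [split => //; ring|nra].
move=> [xy y0]; exists x; first by rewrite /= in_itv /=; nra.
have -> : 1 - x ^+ 2 = y ^+ 2 by lra.
by rewrite sqrtr_sqr ger0_norm.
Qed.

Lemma lower_circleE p : lower_circle p <-> circle R p /\ p.2 <= 0.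
Proof.
case: p => x y; rewrite /circle /=; split.
  move=> [t]; rewrite /= in_itv /= => /andP[t1 t2] [<- <-].
  by rewrite oppr_le0 sqrtr_ge0 sqrrN sqr_sqrtr; [split => //; ring|nra].
move=> [xy y0]; exists x; first by rewrite /= in_itv /=; nra.
have -> : 1 - x ^+ 2 = y ^+ 2 by lra.
by rewrite sqrtr_sqr ler0_norm // opprK.
Qed.

Lemma circleU : circle R = upper_circle `|` lower_circle.
Proof.
apply/seteqP; split => p.
  move=> cp; have [p0|p0] := leP 0 p.2; first by left; apply/upper_circleE.
  by right; apply/lower_circleE; split=> //; exact: ltW.
by move=> [/upper_circleE[]|/lower_circleE[]].
Qed.

(** Project each half circle to [[-1, 1]] and apply [f] above and [g] below. The result is
    continuous by pasting along closed sets and injective on a compact set. *)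
Lemma two_arcs_simple_closed_curve (f g : R -> X) :
    continuous f -> continuous g -> f (-1) = g (-1) -> f 1 = g 1 ->
    (forall s t, -1 <= s <= 1 -> -1 <= t <= 1 -> f s = f t -> s = t) ->
    (forall s t, -1 <= s <= 1 -> -1 <= t <= 1 -> g s = g t -> s = t) ->
    (forall s t, -1 <= s <= 1 -> -1 < t < 1 -> f s <> g t) ->
  exists A : set X, simple_closed_curve R A.
Proof.
move=> cf cg e1 e2 fi gi fg.
pose F (p : R * R) := if 0 <= p.2 then f p.1 else g p.1.
have c1 p : circle R p -> -1 <= p.1 <= 1.
  by rewrite /circle /= => h; nra.
have cend p : circle R p -> p.2 = 0 -> f p.1 = g p.1.
  rewrite /circle /= => + p2; rewrite p2 expr0n addr0 => /eqP.
  by rewrite sqrf_eq1 => /orP[]/eqP ->.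
have cstrict p : circle R p -> p.2 < 0 -> -1 < p.1 < 1.
  by rewrite /circle /= => h p2; nra.
(* The circle is viewed as its image under the identity, so that the quotient criterion compares [F]
   with the identity. *)
exists (F @` circle R); rewrite /simple_closed_curve -[X in homeomorphic X _]image_id.
apply: (compact_quotient_homeomorphic (0, 0)) => //.
- rewrite circleU; apply: compactU.
    exact: upper_circle_compact.
  exact: lower_circle_compact.
- rewrite circleU; apply: withinU_continuous.
  + by apply: compact_closed; [exact: R2_hausdorff|exact: upper_circle_compact].
  + by apply: compact_closed; [exact: R2_hausdorff|exact: lower_circle_compact].
  + apply: (subspace_eq_continuous (f := f \o fst)).
      move=> p; rewrite inE => /upper_circleE[_ p0]; change (f p.1 = F p).
      by rewrite /F p0.
    apply: continuous_subspaceT => p.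
    by apply: continuous_comp; [exact: cvg_fst|exact: cf].
  + apply: (subspace_eq_continuous (f := g \o fst)).
      move=> p; rewrite inE => /lower_circleE[cp p0]; change (g p.1 = F p).
      by rewrite /F; case: ifP => // p0'; apply/esym/cend => //; lra.
    apply: continuous_subspaceT => p.
    by apply: continuous_comp; [exact: cvg_fst|exact: cg].
- by apply: continuous_subspaceT => p; exact: cvg_id.
move=> [x y] [x' y'] cp cq /=; split; first by move=> [-> ->].
have sol : x = x' -> 0 <= y * y' -> y = y'.
  move=> xx; move: cp cq; rewrite /circle /= -xx => cp cq yy.
  have /eqP : y ^+ 2 = y' ^+ 2 by lra.
  rewrite eqf_sqr => /orP[]/eqP // h; move: yy; rewrite h mulNr -expr2 oppr_ge0.
  by rewrite real_exprn_even_le0 ?num_real // => /eqP ->; rewrite oppr0.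
have cx := c1 _ cp; have cx' := c1 _ cq.
rewrite /F /=; have [y0|y0] := leP 0 y; have [y'0|y'0] := leP 0 y'.
- by move=> h; have /= xx := fi _ _ cx cx' h; rewrite (sol xx (mulr_ge0 y0 y'0)) xx.
- by move=> h; have := fg _ _ cx (cstrict _ cq y'0) h.
- by move=> /esym h; have := fg _ _ cx' (cstrict _ cp y0) h.
- move=> h; have /= xx := gi _ _ cx cx' h.
  by rewrite (sol xx (mulr_le0 (ltW y0) (ltW y'0))) xx.
Qed.

End Circle.

(** * Reparametrization *)

Section MonotoneParam.
Variables (R : realType) (X : topologicalType) (d : X -> X -> R).
Hypothesis dd : distance d.
Variable f : R -> X.
Hypothesis cf : continuous f.
Hypothesis f0 : forall t, t <= 0 -> f t = f 0.
Hypothesis fmono : forall s t, s <= t -> f s = f t ->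
  forall u, s <= u -> u <= t -> f u = f s.

(** The points [f (q k)] are dense in the image of [f]; indices coding no rational default to 0. The
    best approach to these points over an initial segment detects when [f] reaches a new value. *)
Let q (k : nat) : R := if @unpickle rat k is Some r then ratr r else 0.
Let v (k : nat) (s : R) : R := 1 - Num.min 1 (d (f s) (f (q k))).
Let u (k : nat) (t : R) : R := sup [set v k s | s in [set s | s <= t]].
Let S (n : nat) (t : R) : R := \sum_(k < n) u k t / 2 ^+ k.+1.

(* Strictly increasing in the initial segment [f @` `]-oo, t]], like a Whitney map. *)
Definition monotone_param (t : R) : R := sup (range (S^~ t)).

Let v_ge0 k s : 0 <= v k s.
Proof. by rewrite subr_ge0 ge_min lexx. Qed.

Let v_le1 k s : v k s <= 1.
Proof. by rewrite gerBl le_min ler01 (dist_ge0 dd). Qed.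

Let v_lip k s t : v k s <= v k t + d (f s) (f t).
Proof.
rewrite /v; have := dist_tri dd (f s) (f t) (f (q k)); rewrite (dist_sym dd (f t) (f s)).
have := dist_ge0 dd (f s) (f t).
by case: (leP 1 (d (f s) (f (q k)))) => ?; case: (leP 1 (d (f t) (f (q k)))) => ?; lra.
Qed.

Let u_sup k t : has_sup [set v k s | s in [set s | s <= t]].
Proof.
split; first by exists (v k t), t => /=.
by exists 1 => _ [s _ <-].
Qed.

Let v_le_u k s t : s <= t -> v k s <= u k t.
Proof. by move=> st; apply: ub_le_sup; [case: (u_sup k t)|exists s]. Qed.

Let u_le k t c : (forall s, s <= t -> v k s <= c) -> u k t <= c.
Proof. by move=> H; apply: ge_sup; [case: (u_sup k t)|move=> _ [s st <-]; exact: H]. Qed.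

Let u_ge0 k t : 0 <= u k t.
Proof. exact: le_trans (v_ge0 k t) (v_le_u k (lexx t)). Qed.

Let u_le1 k t : u k t <= 1.
Proof. by apply: u_le => s _. Qed.

Let u_mono k s t : s <= t -> u k s <= u k t.
Proof. by move=> st; apply: u_le => w ws; apply: v_le_u; exact: le_trans st. Qed.

Let pow2 k : 0 < (2 : R) ^+ k. Proof. exact: exprn_gt0. Qed.

Let S_le n s t c : 0 <= c -> (forall k, u k t <= u k s + c) -> S n t <= S n s + c.
Proof.
(* The first [n] weights sum to [1 - 1 / 2 ^ n]; this sharper bound carries the induction. *)
move=> c0 H; suff : S n t <= S n s + (c - c / 2 ^+ n).
  by have : 0 <= c / 2 ^+ n by [rewrite divr_ge0 // ltW]; lra.
elim: n => [|n IH]; first by rewrite /S !big_ord0 expr0; lra.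
rewrite /S !big_ord_recr -/(S n t) -/(S n s) /=.
have : u n t / 2 ^+ n.+1 <= u n s / 2 ^+ n.+1 + c / 2 ^+ n.+1.
  by rewrite -mulrDl ler_pM2r ?invr_gt0.
move: IH; have -> : c / 2 ^+ n = 2 * (c / 2 ^+ n.+1).
  by have := lt0r_neq0 (pow2 n); rewrite exprS => h; field.
lra.
Qed.

Let S_mono n s t : s <= t -> S n s <= S n t.
Proof.
move=> st; have := @S_le n t s 0 (lexx _); rewrite addr0; apply.
by move=> k; rewrite addr0; exact: u_mono.
Qed.

Let S_le1 n t : S n t <= 1.
Proof.
suff : S n t <= 1 - 1 / 2 ^+ n.
  by have : 0 <= 1 / 2 ^+ n :> R by [rewrite divr_ge0 // ltW]; lra.
elim: n => [|n IH]; first by rewrite /S !big_ord0 expr0; lra.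
rewrite /S !big_ord_recr -/(S n t) /=.
have : u n t / 2 ^+ n.+1 <= 1 / 2 ^+ n.+1 by rewrite ler_pM2r ?invr_gt0.
move: IH; have -> : 1 / 2 ^+ n = 2 * (1 / 2 ^+ n.+1) :> R.
  by have := lt0r_neq0 (pow2 n); rewrite exprS => h; field.
lra.
Qed.

Let S_sup t : has_sup (range (S^~ t)).
Proof. by split; [exists (S 0 t), 0%N|exists 1 => _ [n _ <-]]. Qed.

Let S_le_phi n t : S n t <= monotone_param t.
Proof. by apply: ub_le_sup; [case: (S_sup t)|exists n]. Qed.

Let phi_le t c : (forall n, S n t <= c) -> monotone_param t <= c.
Proof. by move=> H; apply: ge_sup; [case: (S_sup t)|move=> _ [n _ <-]]. Qed.

Let phi_leD s t c : 0 <= c -> (forall k, u k t <= u k s + c) ->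
  monotone_param t <= monotone_param s + c.
Proof.
move=> c0 H; apply: phi_le => n; apply: (le_trans (S_le n c0 H)).
by rewrite lerD2r.
Qed.

Lemma monotone_param_le s t : s <= t -> monotone_param s <= monotone_param t.
Proof. by move=> st; apply: phi_le => n; exact: le_trans (S_mono n st) _. Qed.

(** Lengthening an initial segment a little adds only points close to its last one, so all [u k]
    grow by a uniformly small amount. *)
Lemma monotone_param_continuous : continuous monotone_param.
Proof.
move=> t; apply/cvgrPdist_lt => e e0.
have e4 : 0 < e / 4 by lra.
have [h h0 H] := iffLR (continuous_distP dd f) cf t _ e4.
apply/nbhs_ballP; exists h => //= s; rewrite /ball /= => ts.
suff osc a b : `|t - a| < h -> `|t - b| < h -> a <= b ->
    monotone_param b <= monotone_param a + e / 2.
  have tt : `|t - t| < h by rewrite subrr normr0.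
  rewrite ltr_norml; have [st|/ltW st] := leP s t.
    by have := osc s t ts tt st; have := monotone_param_le st; lra.
  by have := osc t s tt ts st; have := monotone_param_le st; lra.
move=> ta tb ab; apply: phi_leD => [|k]; first lra.
apply: u_le => w wb; have [wa|aw] := leP w a.
  by have := v_le_u k wa; lra.
have tw : `|t - w| < h by move: ta tb; rewrite !ltr_norml; lra.
have := v_lip k w a; have := v_le_u k (lexx a).
have := H _ tw; have := H _ ta; have := dist_tri dd (f t) (f w) (f a).
by rewrite (dist_sym dd (f w) (f t)); lra.
Qed.

(** The other terms of the series are monotone, so nothing compensates the growth of the [k]-th
    one. *)
Let phi_lt k s t c : 0 < c -> s <= t -> u k s + c <= u k t ->
  monotone_param s < monotone_param t.
Proof.
move=> c0 st uc; have c'0 : 0 < c / 2 ^+ k.+1 by rewrite divr_gt0.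
suff : monotone_param s <= monotone_param t - c / 2 ^+ k.+1 by lra.
apply: phi_le => n.
have key m : S m s + (if (k < m)%N then c / 2 ^+ k.+1 else 0) <= S m t.
  elim: m => [|m IH]; first by rewrite /S !big_ord0 addr0.
  rewrite /S !big_ord_recr -/(S m t) -/(S m s) /=.
  have um : u m s / 2 ^+ m.+1 <= u m t / 2 ^+ m.+1.
    by rewrite ler_pM2r ?invr_gt0 // u_mono.
  rewrite ltnS leq_eqVlt; have [e|ne] := eqVneq k m; last by move: IH => /=; lra.
  rewrite -e in um IH *; rewrite ltnn in IH; rewrite /=.
  have : u k s / 2 ^+ k.+1 + c / 2 ^+ k.+1 <= u k t / 2 ^+ k.+1.
    by rewrite -mulrDl ler_pM2r ?invr_gt0.
  by move: IH; lra.
have Smono m1 m2 : (m1 <= m2)%N -> S m1 s <= S m2 s.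
  move=> /subnK <-; elim: (m2 - m1)%N => // i IH.
  rewrite addSn /S big_ord_recr -/(S (i + m1) s) /=; apply: (le_trans IH).
  by rewrite lerDl divr_ge0 // ltW.
have := key (n + k.+1)%N; rewrite ltn_addl // => h.
have := Smono _ _ (leq_addr k.+1 n); have := S_le_phi (n + k.+1) t; lra.
Qed.

(** If [f s = f t], the segment up to [t] has no new values. Otherwise [f t] is at positive distance
    from all values up to [s], and a rational just after [t] gives an index at which [u]
    increases. *)
Lemma monotone_param_eq s t : s <= t ->
  monotone_param s = monotone_param t <-> f s = f t.
Proof.
move=> st; split; last first.
  move=> fst_; apply: le_anti; rewrite monotone_param_le //= -[leRHS]addr0.
  apply: phi_leD => // k; rewrite addr0; apply: u_le => w wt.
  have [ws|/ltW sw] := leP w s; first exact: v_le_u.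
  by rewrite /v (fmono st fst_ sw wt); exact: v_le_u.
move=> phist; apply: contrapT => nfst.
pose g w := d (f w) (f t).
have cg : continuous g.
  move=> w; apply/cvgrPdist_lt => e e0.
  have [h h0 H] := iffLR (continuous_distP dd f) cf w _ e0.
  apply/nbhs_ballP; exists h => //= x /H; rewrite ltr_norml /g.
  have := dist_tri dd (f w) (f x) (f t); have := dist_tri dd (f x) (f w) (f t).
  by rewrite (dist_sym dd (f x) (f w)); lra.
(* As [f] is constant on the negative half-line, the infimum of [g] over all [w <= s] is a minimum
   over this compact interval. *)
have m0s : Num.min 0 s <= s by rewrite ge_min lexx orbT.
have [w0 w0i w0P] :=
  EVT_min m0s (continuous_subspaceT (A := `[Num.min 0 s, s]%classic) cg).
have gpos w : w <= s -> 0 < g w.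
  move=> ws; rewrite lt_neqAle dist_ge0 // andbT; apply/eqP => /esym/(dist_sep dd) e.
  by apply: nfst; rewrite -e; apply: fmono (ws) (st); [exact: le_trans st|].
have gw0 w : w <= s -> g w0 <= g w.
  move=> ws; have [mw|wm] := leP (Num.min 0 s) w.
    by apply: w0P; rewrite in_itv /= mw.
  have e : f w = f (Num.min 0 s).
    move: wm; rewrite lt_min => /andP[/ltW w0_ _].
    by rewrite (f0 w0_) [RHS]f0 // ge_min lexx.
  by rewrite /g e; apply: w0P; rewrite in_itv /= lexx.
have w0s : w0 <= s by move: w0i; rewrite in_itv /= => /andP[].
(* The cap at 1 matches the truncation in [v]. A point within [c / 3] of [f t] is at least
   [2 * (c / 3)] from every value up to [s], so [u] grows by at least [c / 3]. *)
pose c := Num.min 1 (g w0).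
have [c0 c1 cg0] : [/\ 0 < c, c <= 1 & c <= g w0].
  by rewrite lt_min ltr01 gpos // !ge_min !lexx orbT.
have c30 : 0 < c / 3 by lra.
have [h h0 H] := iffLR (continuous_distP dd f) cf t _ c30.
have [|r] := @rat_in_itvoo R t (t + h); first by rewrite ltrDl.
rewrite in_itv /= => /andP[tr rth].
have qr : q (pickle r) = ratr r by rewrite /q pickleK.
have tp : d (f t) (f (q (pickle r))) < c / 3.
  by apply: H; rewrite qr ltr_norml; lra.
suff : monotone_param s < monotone_param t by rewrite phist ltxx.
apply: (@phi_lt (pickle r) s t (c / 3)) => //.
have ut : 1 - c / 3 <= u (pickle r) t.
  apply: le_trans (v_le_u (pickle r) (lexx t)).
  by rewrite /v lerB // ge_min (ltW tp) orbT.
suff : u (pickle r) s <= 1 - 2 * (c / 3) by move: ut; lra.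
apply: u_le => w ws; rewrite /v lerB // le_min; apply/andP; split; first lra.
have := dist_tri dd (f (q (pickle r))) (f w) (f t).
have := gw0 w ws; rewrite /g (dist_sym dd (f (q _)) (f t)); move: cg0 tp.
by rewrite /g; lra.
Qed.

End MonotoneParam.

(** * Points of arcs are cut points *)

Section InjectivePaths.
Variables (R : realType) (X : topologicalType) (d : X -> X -> R).
Hypothesis dd : distance d.

Lemma affine_continuous (a b : R) : continuous (fun t : R => a + (t + 1) / 2 * (b - a)).
Proof.
move=> t; apply: cvgD; first exact: cvg_cst.
apply: cvgMl; apply: cvgMl; apply: cvgD; [exact: cvg_id|exact: cvg_cst].
Qed.

Lemma affine_itv (a b t : R) : a <= b -> -1 <= t <= 1 ->
  a <= a + (t + 1) / 2 * (b - a) <= b.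
Proof. by move=> ab /andP[t1 t2]; apply/andP; split; nra. Qed.

Lemma affine_oitv (a b t : R) : a < b -> -1 < t < 1 ->
  a < a + (t + 1) / 2 * (b - a) < b.
Proof. by move=> ab /andP[t1 t2]; apply/andP; split; nra. Qed.

Lemma affine_inj (a b s t : R) : a < b ->
  a + (s + 1) / 2 * (b - a) = a + (t + 1) / 2 * (b - a) -> s = t.
Proof.
move=> ab /addrI /mulIf; rewrite subr_eq0 gt_eqF // => /(_ isT); lra.
Qed.

(** The loop-erased path and its monotone parameter have the same fibers, so the path factors
    injectively through the parameter, whose range is rescaled to [[-1, 1]]. *)
Lemma injective_path (O : set X) (g : R -> X) : continuous g -> g 0 <> g 1 ->
    (forall t, O (g t)) ->
  exists h : R -> X, [/\ continuous h, h (-1) = g 0, h 1 = g 1, forall t, O (h t)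
    & forall s t, -1 <= s <= 1 -> -1 <= t <= 1 -> h s = h t -> s = t].
Proof.
move=> cg g01 Og.
have [f' [cf' f'0 f'1 f'g f'mono]] := loop_erase dd cg.
(* Clamping extends the fiber condition from [[0, 1]] to the whole line. *)
pose f := f' \o clamp 0 1.
have cl0 : clamp 0 1 (0 : R) = 0 by rewrite clamp_id // lexx ler01.
have cl1 : clamp 0 1 (1 : R) = 1 by rewrite clamp_id // lexx ler01.
have cf : continuous f by apply: continuous_clamp => //; exact: continuous_subspaceT.
have f0 t : t <= 0 -> f t = f 0 by move=> t0; rewrite /f /= cl0 /clamp t0.
have fmono s t : s <= t -> f s = f t -> forall u, s <= u -> u <= t -> f u = f s.
  move=> st e u su ut; apply: (f'mono _ (clamp 0 1 t)) => //.
  - by have /andP[] := clamp_itv (@ler01 R) s.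
  - exact: clamp_le.
  - by have /andP[] := clamp_itv (@ler01 R) t.
  - exact: clamp_le.
  - exact: clamp_le.
pose phi := monotone_param d f.
have cphi : continuous phi by exact: monotone_param_continuous.
have phi_le s t : s <= t -> phi s <= phi t by exact: monotone_param_le.
have phi_eq s t : phi s = phi t <-> f s = f t.
  have [st|/ltW st] := leP s t; first exact: monotone_param_eq.
  have [e1 e2] := monotone_param_eq dd cf f0 fmono st.
  by split=> /esym e; apply/esym; [exact: e1|exact: e2].
have phi01 : phi 0 < phi 1.
  rewrite lt_neqAle phi_le // andbT; apply/eqP => /phi_eq.
  by rewrite /f /= cl0 cl1 f'0 f'1.
have [h [ch hphi]] := @compact_factor R X R `[0, 1]%classic 0 f phi
  (@segment_compact _ _ _) (@Rhausdorff R) (continuous_subspaceT cf)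
  (continuous_subspaceT cphi) (fun s t _ _ => iffLR (phi_eq s t)).
have img w : phi 0 <= w <= phi 1 -> exists2 s, 0 <= s <= 1 & phi s = w.
  move=> w01; have [|s] := @IVT R phi 0 1 w ler01 (continuous_subspaceT cphi).
    by rewrite (min_idPl _) ?(max_idPr _) // ltW.
  by rewrite in_itv /= => ?; exists s.
pose aff (t : R) := phi 0 + (t + 1) / 2 * (phi 1 - phi 0).
have hval w : phi 0 <= w <= phi 1 -> exists s, phi s = w /\ h w = f s.
  by move=> /img[s s01 <-]; exists s; rewrite hphi //= in_itv.
have Of s : O (f s) by rewrite /f /=; have [x ->] := f'g (clamp 0 1 s).
exists (h \o clamp (phi 0) (phi 1) \o aff).
have cid t : -1 <= t <= 1 -> clamp (phi 0) (phi 1) (aff t) = aff t.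
  by move=> t1; apply: clamp_id; [exact: ltW|apply: affine_itv => //; exact: ltW].
split.
- move=> t; apply: continuous_comp; first exact: affine_continuous.
  apply: continuous_clamp; first exact: ltW.
  apply: (continuous_subspaceW _ ch) => w; rewrite /= in_itv /= => /img[s s01 <-].
  by exists s => //=; rewrite in_itv.
- rewrite /= cid; last by lra.
  by rewrite /aff addNr !mul0r addr0 hphi /= ?in_itv /= ?lexx ?ler01 // /f /= cl0.
- rewrite /= cid; last by lra.
  rewrite (_ : aff 1 = phi 1); last by rewrite /aff; field.
  by rewrite hphi /= ?in_itv /= ?lexx ?ler01 // /f /= cl1.
- move=> t /=; have [s [_ ->]] := hval _ (clamp_itv (ltW phi01) (aff t)).
  exact: Of.
- move=> s t s1 t1 /=; rewrite !cid //.
  have [s' [es ->]] := hval _ (affine_itv (ltW phi01) s1).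
  have [t' [et ->]] := hval _ (affine_itv (ltW phi01) t1).
  by move=> /phi_eq e; apply: (affine_inj phi01); rewrite -es -et.
Qed.

(** Let [t0] be the last time [g] meets the part of the arc up to [f s0], and [t1] the first later
    time it meets the rest. In between [g] misses the arc, and closes up with the subarc between the
    two meeting points. *)
Lemma crossing_paths_simple_closed_curve (f g : R -> X) (s0 : R) :
    continuous f -> continuous g ->
    (forall s t, 0 <= s <= 1 -> 0 <= t <= 1 -> f s = f t -> s = t) ->
    (forall s t, -1 <= s <= 1 -> -1 <= t <= 1 -> g s = g t -> s = t) ->
    g (-1) = f 0 -> g 1 = f 1 -> 0 <= s0 <= 1 -> (forall t, g t <> f s0) ->
  exists A : set X, simple_closed_curve R A.
Proof.
move=> cf cg fi gi g0 g1 s01 gf.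
have cl (a b : R) : open (~` (g @^-1` (f @` `[a, b]))).
  apply: closed_openC; apply: closed_comp => [t _|]; first exact: cg.
  apply: compact_closed; first exact: dist_hausdorff dd.
  by apply: continuous_compact; [exact: continuous_subspaceT|exact: segment_compact].
have inI (x : R) a b : (`[a, b]%classic : set R) x = (a <= x <= b) by rewrite /= in_itv.
have [|t0 [t01 nt0 t0U]] := last_out (t := 1) (cl 0 s0).
  exists (-1); first lra.
  by apply; exists 0; [rewrite inI; lra|rewrite g0].
have t0m : -1 <= t0.
  rewrite leNgt; apply/negP => h; apply: (t0U (-1) h); first lra.
  by exists 0; [rewrite inI; lra|rewrite g0].
move: nt0 => /contrapT[a + fa]; rewrite inI => a0.
have [|t1 [t0t1 nt1 t1U]] := first_out (t := t0) (cl s0 1).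
  exists 1 => //.
  by apply; exists 1; [rewrite inI; lra|rewrite g1].
have t1m : t1 <= 1.
  rewrite leNgt; apply/negP => h; apply: (t1U 1 h) => //.
  by exists 1; [rewrite inI; lra|rewrite g1].
move: nt1 => /contrapT[b + fb]; rewrite inI => b0.
have as0 : a < s0.
  rewrite lt_neqAle; apply/andP; split; last by lra.
  by apply/eqP => e; apply: (gf t0); rewrite -fa e.
have s0b : s0 < b.
  rewrite lt_neqAle; apply/andP; split; last by lra.
  by apply/eqP => e; apply: (gf t1); rewrite -fb e.
have lt01 : t0 < t1.
  rewrite lt_neqAle t0t1 andbT; apply/eqP => e.
  have : a = b by apply: fi; [lra|lra|rewrite fa fb e].
  by lra.
have ab : a < b by lra.
apply: (@two_arcs_simple_closed_curve R X (dist_hausdorff dd)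
  (fun t => f (a + (t + 1) / 2 * (b - a)))
  (fun t => g (t0 + (t + 1) / 2 * (t1 - t0)))).
- by move=> t; apply: continuous_comp; [exact: affine_continuous|exact: cf].
- by move=> t; apply: continuous_comp; [exact: affine_continuous|exact: cg].
- by rewrite addNr !mul0r !addr0.
- by have E (x y : R) : x + (1 + 1) / 2 * (y - x) = y by [field]; rewrite !E.
- move=> s t s1 t1'; have := affine_itv (ltW ab) s1; have := affine_itv (ltW ab) t1'.
  by move=> h1 h2 /fi e; apply: (affine_inj ab); apply: e; lra.
- move=> s t s1 t1'; have := affine_itv (ltW lt01) s1; have := affine_itv (ltW lt01) t1'.
  by move=> h1 h2 /gi e; apply: (affine_inj lt01); apply: e; lra.
- move=> s t s1 t1'; have := affine_itv (ltW ab) s1; have := affine_oitv lt01 t1'.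
  set v := t0 + _; set w := a + _ => hv hw e.
  have [ws|sw] := leP w s0.
  + by apply: (t0U v); [lra|lra|exists w; [rewrite inI; lra|]].
  + by apply: (t1U v); [lra|lra|exists w; [rewrite inI; lra|]].
Qed.

End InjectivePaths.

Lemma open_arc_arc (R : realType) (X : topologicalType) (x y z : X) :
  open_arc R x y z -> is_arc R x y (dendrite_arc R x y).
Proof.
rewrite /open_arc /dendrite_arc => -[Az _].
by move: Az; case: xgetP => [A _ /= arcA _|].
Qed.

Lemma open_arc_separates (R : realType) (X : topologicalType) (x y z : X) :
    dendrite R X -> open_arc R x y z ->
  ~ connected_component (~` [set z]) x y.
Proof.
move=> [[_ cX _ [M /homeomorphic_distance[d dd]]] lc noSCC] xyz cxy; apply: noSCC.
have [f [g [[[cf _] fA gA fK gK] f0 f1]]] := open_arc_arc xyz.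
have [Az zxy] := xyz.
have s01 := gA z Az.
have zE : f (g z) = z by apply: gK; rewrite inE.
have oz : open (~` [set z]).
  apply: closed_openC; apply: accessible_closed_set1.
  exact/hausdorff_accessible/(dist_hausdorff dd).
have xz : (~` [set z]) x by move=> /= e; apply: zxy; left.
have [gm [cgm gm0 gm1 gmz]] := connected_path dd cX lc oz
  (@component_connected _ (~` [set z]) x) (@connected_component_sub _ _ _)
  (connected_component_refl xz) cxy.
have fi s t : 0 <= s <= 1 -> 0 <= t <= 1 -> f s = f t -> s = t.
  by move=> s1 t1 e; rewrite -(fK s) ?inE /= ?in_itv // e fK // inE /= in_itv.
have xy : gm 0 <> gm 1.
  rewrite gm0 gm1 -f0 -f1 => /fi; rewrite !lexx ler01 => /(_ isT isT) /eqP.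
  by rewrite eq_sym oner_eq0.
have [h [ch h0 h1 hz hi]] := injective_path dd cgm xy gmz.
have cid (s : R) : 0 <= s <= 1 -> clamp 0 1 s = s by apply: clamp_id.
move: s01; rewrite /= in_itv /= => s01.
apply: (@crossing_paths_simple_closed_curve R X d dd (f \o clamp 0 1) h (g z)) => //.
- exact: continuous_clamp.
- by move=> s t s1 t1; rewrite /= !cid //; exact: fi.
- by rewrite /= cid ?f0 ?h0 // lexx ler01.
- by rewrite /= cid ?f1 ?h1 // lexx ler01.
- by move=> t /=; rewrite cid // zE => e; exact: (hz t).
Qed.

(** * Branch points *)

Lemma open_component (X : topologicalType) (O : set X) x :
  locally_connected X -> open O -> open (connected_component O x).
Proof.
move=> lc oO; rewrite openE => y cy.
have Oy : O y by exact: connected_component_sub cy.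
have [V [oV cV Vy VO]] := lc y O (open_nbhs_nbhs (conj oO Oy)).
apply: (filterS _ (open_nbhs_nbhs (conj oV Vy))) => z Vz.
apply: connected_component_trans cy _.
exact: (connected_component_max Vy VO cV).
Qed.

Lemma arc_connected (R : realType) (X : topologicalType) (x y : X) (A : set X) :
  is_arc R x y A -> [/\ connected A, A x & A y].
Proof.
move=> [f [g [[[cf cg] fA gA fK gK] <- <-]]].
have -> : A = f @` `[0, 1].
  apply/seteqP; split => z; last by move=> [t t01 <-]; exact: fA.
  by move=> Az; exists (g z); [exact: gA|apply: gK; rewrite inE].
split; first by apply: connected_continuous_connected => //; exact: segment_connected.
- by exists 0 => //=; rewrite in_itv /= lexx ler01.
- by exists 1 => //=; rewrite in_itv /= lexx ler01.
Qed.

Lemma arc_setD1_connected (R : realType) (X : topologicalType) (x y : X) (A : set X) :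
  is_arc R x y A -> connected (A `\ y).
Proof.
move=> [f [g [[[cf cg] fA gA fK gK] f0 f1]]].
have m1 : (1 : R) \in `[0, 1]%classic by rewrite inE /= in_itv /= lexx ler01.
have -> : A `\ y = f @` `[0, 1[.
  apply/seteqP; split => z.
    move=> [Az zy]; exists (g z); last by apply: gK; rewrite inE.
    have /= := gA z Az; rewrite !in_itv /= => /andP[-> g1].
    rewrite lt_neqAle g1 andbT; apply/eqP => e; apply: zy => /=.
    by rewrite -f1 -e gK // inE.
  move=> [t /=]; rewrite in_itv /= => /andP[t0 t1] <-.
  have tI : t \in `[0, 1]%classic by rewrite inE /= in_itv /= t0 ltW.
  split; first by apply: fA; rewrite inE in tI.
  by rewrite /= -f1 => e; move: t1; rewrite -(fK t tI) e fK // ltxx.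
apply: connected_continuous_connected.
  exact/connected_intervalP/interval_is_interval.
by apply: (continuous_subspaceW _ cf) => t; rewrite /= !in_itv /= => /andP[-> /ltW].
Qed.

(** If [w] were off [[x, y]], that arc would join [x] to [z] without [w]. If [w = y], then [[x, z]]
    without [z] would join [x] to [y]. Both contradict separation. *)
Lemma open_arc_sub (R : realType) (X : topologicalType) (x y z w : X) :
    dendrite R X -> x <> z -> open_arc R x y z -> open_arc R x z w ->
  open_arc R x y w.
Proof.
move=> dX xz xyz xzw; have [Az zxy] := xyz; have [Bw wxz] := xzw.
have arcA := open_arc_arc xyz; have arcB := open_arc_arc xzw.
have [cA Ax Ay] := arc_connected arcA; have [_ Bx Bz] := arc_connected arcB.
have wx : w <> x by move=> e; apply: wxz; left.
have wz : w <> z by move=> e; apply: wxz; right.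
split.
  apply: contrapT => nAw; apply: (open_arc_separates dX xzw).
  by apply: (connected_component_max Ax _ cA Az) => t At /= e; apply: nAw; rewrite -e.
move=> [//|/= wy]; apply: (open_arc_separates dX xyz).
apply: (connected_component_max (B := dendrite_arc R x z `\ z)).
- by split.
- by move=> t [].
- exact: arc_setD1_connected arcB.
- by rewrite -wy.
Qed.

Lemma open_arc_neq (R : realType) (X : topologicalType) (x y z : X) :
  open_arc R x y z -> x <> z /\ y <> z.
Proof. by move=> [_ zxy]; split => e; apply: zxy; [left|right]. Qed.

(** If [b'] differs from [b], at least two of the three components at [b] miss it. Their closures
    share [b], so their union is connected and joins two of the points without [b']. *)
Lemma separated_triple_uniq (X : topologicalType) (b b' : X) (p : 'I_3 -> X) :
    hausdorff_space X -> connected [set: X] -> locally_connected X ->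
    (forall i, p i <> b) ->
    (forall i j, i != j -> ~ connected_component (~` [set b]) (p i) (p j)) ->
    (forall i j, i != j -> ~ connected_component (~` [set b']) (p i) (p j)) ->
  b = b'.
Proof.
move=> hX cX lc pb sep sep'; apply: contrapT => bb'.
pose cp i := connected_component (~` [set b]) (p i).
have ob : open (~` [set b]).
  by apply: closed_openC; apply: accessible_closed_set1; exact: hausdorff_accessible.
have [i [j [ij ni nj]]] : exists i j, [/\ i != j, ~ cp i b' & ~ cp j b'].
  have tr i j : i != j -> cp i b' -> ~ cp j b'.
    move=> ij ci cj; apply: (sep i j ij); apply: connected_component_trans ci _.
    exact: connected_component_sym.
  pose k0 : 'I_3 := ord0; pose k1 : 'I_3 := inord 1; pose k2 : 'I_3 := inord 2.
  have k01 : k0 != k1 by rewrite -val_eqE /= inordK.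
  have k02 : k0 != k2 by rewrite -val_eqE /= inordK.
  have k12 : k1 != k2 by rewrite -val_eqE /= !inordK.
  have [c0|n0] := pselect (cp k0 b').
    by exists k1, k2; split => //; apply: tr c0.
  have [c1|n1] := pselect (cp k1 b').
    by exists k0, k2; split => //; apply: tr c1.
  by exists k0, k1.
(* Components are open, so closure can add only [b]; it does add [b], as otherwise the component
   would be clopen. *)
have cl k w : closure (cp k) w -> w <> b -> cp k w.
  move=> cw wb; have ow := open_component w lc ob.
  have cww : connected_component (~` [set b]) w w by exact: connected_component_refl.
  have [v [kv wv]] := cw _ (open_nbhs_nbhs (conj ow cww)).
  by apply: connected_component_trans kv _; exact: connected_component_sym.
have pk k : cp k (p k) by apply: connected_component_refl; exact: pb.
have clb k : closure (cp k) b.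
  apply: contrapT => nb.
  have E : closure (cp k) = cp k.
    apply/seteqP; split; last exact: subset_closure.
    by move=> w cw; apply: cl => // e; apply: nb; rewrite -e.
  have T : cp k = setT.
    apply: cX; first by exists (p k); exact: pk.
    - by exists (cp k); [exact: open_component|rewrite setTI].
    - by exists (cp k); [rewrite -E; exact: closed_closure|rewrite setTI].
  have : cp k b by rewrite T.
  by move/(@connected_component_sub _ _ _ _); apply.
have clb' k : ~ cp k b' -> closure (cp k) `<=` ~` [set b'].
  move=> nk w cw /= e; apply: nk; rewrite -e; apply: cl => // e'.
  by apply: bb'; rewrite -e' e.
apply: (sep' i j ij).
apply: (connected_component_max (B := closure (cp i) `|` closure (cp j))).
- by left; apply: subset_closure; exact: pk.
- by move=> w [|]; exact: clb'.
- apply: connectedU; first by exists b; split; exact: clb.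
  + by apply: connected_closure; exact: component_connected.
  + by apply: connected_closure; exact: component_connected.
- by right; apply: subset_closure; exact: pk.
Qed.

Lemma compact_distance_dense (R : realType) (X : topologicalType) (d : X -> X -> R)
    (x0 : X) : distance d -> compact [set: X] ->
  exists p : nat * nat -> X, forall U : set X, open U -> U !=set0 -> exists k, U (p k).
Proof.
move=> dd cX.
have net n : exists s : seq X, forall x, exists2 y, y \in s & d y x < n.+1%:R^-1.
  have e0 : 0 < n.+1%:R^-1 :> R by rewrite invr_gt0 ltr0n.
  (* Finite sequences are filtered by inclusion: near [x], the net property holds as soon as [x] is
     listed. *)
  pose F : set_system (seq X) :=
    filter_from [set: seq X] (fun s0 => [set s : seq X | {subset s0 <= s}]).
  have FF : Filter F.
    apply: filter_from_filter; first by exists [::].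
    move=> s1 s2 _ _; exists (s1 ++ s2) => // s sub.
    by split => y ys; apply: sub; rewrite mem_cat ys ?orbT.
  move: cX => /compact_near_coveringP/(_ _ F
    (fun s x => exists2 y, y \in s & d y x < n.+1%:R^-1) FF).
  case=> [x _|s0 _ H]; last by exists s0 => x; exact: (H s0).
  exists ([set y | d x y < n.+1%:R^-1], [set s : seq X | {subset [:: x] <= s}]).
    by split; [exact: dist_ball_nbhs|exists [:: x]].
  by move=> [y s] [/= xy sub]; exists x => //; apply: sub; rewrite inE.
have /choice[s sP] := net.
exists (fun k => nth x0 (s k.1) k.2) => U oU [x Ux].
have /(dist_nbhs dd)[e e0 eU] := open_nbhs_nbhs (conj oU Ux).
pose n := Num.truncn e^-1.
have [y ys yx] := sP n x.
exists (n, index y (s n)); rewrite /= nth_index //; apply: eU.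
rewrite (dist_sym dd); apply: (lt_trans yx).
by rewrite invf_plt ?posrE ?ltr0n //; exact: truncnS_gt.
Qed.

Lemma branch_countable (R : realType) (X : topologicalType) :
  dendrite R X -> countable (branch X).
Proof.
move=> [[[x0 _] cX cnX [M /homeomorphic_distance[d dd]]] lc _].
have hX := dist_hausdorff dd.
have [p pP] := compact_distance_dense x0 dd cX.
have ob (b : X) : open (~` [set b]).
  by apply: closed_openC; apply: accessible_closed_set1; exact: hausdorff_accessible.
(* The three indices form a finite function, whose type is countable, so that it can be pickled into
   a code of [b]. *)
have /choice[t tP] b : exists t : {ffun 'I_3 -> nat * nat}, branch X b ->
    (forall i, p (t i) <> b) /\
    (forall i j, i != j -> ~ connected_component (~` [set b]) (p (t i)) (p (t j))).
  have [Bb|nB] := pselect (branch X b); last by exists [ffun=> (0, 0)%N] => /nB.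
  have /card_leP[f] := Bb.
  have fi : injective f by move=> u v; apply: inj; rewrite inE.
  pose C (i : 'I_3) : set X := set_val (f (exist _ (val i) (mem_set (ltn_ord i)))).
  have C_inj i j : C i = C j -> i = j.
    move=> e; have /fi e' := val_inj e; apply: ord_inj.
    exact: (congr1 (fun u => sval u) e').
  have CP i : exists2 w, (~` [set b]) w & connected_component (~` [set b]) w = C i.
    exact: set_valP (f (exist _ (val i) (mem_set (ltn_ord i)))).
  have /choice[k kP] i : exists k, C i (p k).
    have [w wb <-] := CP i.
    by apply: pP; [exact: open_component|exists w; exact: connected_component_refl].
  exists (finfun k) => _; split.
    move=> i; rewrite ffunE => e; have := kP i; have [w wb <-] := CP i.
    by rewrite e => /(@connected_component_sub _ _ _ _); exact.
  move=> i j ij; rewrite !ffunE => cij.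
  have := kP i; have := kP j.
  have [wi _ Ei] := CP i; have [wj _ Ej] := CP j.
  rewrite -Ei -Ej => cj ci.
  have : connected_component (~` [set b]) wi wj.
    apply: (connected_component_trans ci); apply: (connected_component_trans cij).
    exact: connected_component_sym.
  by move=> /same_connected_component; rewrite Ei Ej => /C_inj e; rewrite e eqxx in ij.
apply/countable_injP; exists (fun b => pickle (t b)) => b b'.
rewrite !inE => Bb Bb' /(pcan_inj pickleK) e.
have [pb sb] := tP b Bb; have [_ sb'] := tP b' Bb'.
apply: (@separated_triple_uniq X b b' (fun i => p (t b i))) => //.
by move=> i j; rewrite e; exact: sb'.
Qed.

(** Codes are avoided one at a time: if the point [z] found has the newly forbidden code, search
    again in [(x, z)], which excludes [z]. *)
Lemma branch_in_open_arc (R : realType) (n : option nat) (X : topologicalType)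
    (code : X -> nat) (L : seq nat) (x y : X) :
    wazewski_dendrite R n X -> {in branch X &, injective code} -> x <> y ->
  exists z, [/\ open_arc R x y z, branch X z & code z \notin L].
Proof.
move=> [dX _ _ arcs] ci; elim: L y => [|m L IH] y xy.
  by have [z []] := arcs _ _ xy; exists z.
have [z [xyz Bz zL]] := IH y xy.
have [e|zm] := eqVneq (code z) m; last by exists z; split; rewrite // inE negb_or zm.
have [xz _] := open_arc_neq xyz.
have [w [xzw Bw wL]] := IH z xz.
exists w; split => //; first exact: open_arc_sub xz xyz xzw.
rewrite inE negb_or wL andbT -e; apply/eqP => /ci; rewrite !inE => /(_ Bw Bz) wz.
by have [_] := open_arc_neq xzw; rewrite wz.
Qed.

(** * Colorings *)

(** A first transposition sends [a] to [i]; a second moves the image of [b] to [j] and fixes [i]. *)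
Lemma exists_bijection2 (T : eqType) (a b i j : T) : a <> b -> i <> j ->
  exists s : T -> T, [/\ bijective s, s a = i & s b = j].
Proof.
pose sw (u v x : T) := if x == u then v else if x == v then u else x.
have swK u v : involutive (sw u v).
  move=> x; rewrite /sw; have [->|xu] := eqVneq x u.
    by have [->|_] := eqVneq v u; rewrite ?eqxx.
  have [->|xv] := eqVneq x v; first by rewrite eqxx.
  by rewrite (negbTE xu) (negbTE xv).
have swu u v : sw u v u = v by rewrite /sw eqxx.
have sw_out u v x : x <> u -> x <> v -> sw u v x = x.
  by rewrite /sw => /eqP/negbTE -> /eqP/negbTE ->.
move=> ab ij; exists (sw (sw a i b) j \o sw a i); split.
- by apply: bij_comp; exact: inv_bij.
- rewrite /= swu sw_out // => e.
  by apply: ab; apply: (inv_inj (swK a i)); rewrite swu.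
- by rewrite /= swu.
Qed.

Section Colorings.
Variables (n : option nat) (X : topologicalType).

Lemma color_open (x : branch X) (C : components_at (set_val x)) (i : colors n) :
  open [set c : coloring n X | color (set_val c) C = i].
Proof.
pose ev (c : color_maps n X) : discrete_topology (colors n) := c (existT _ x C).
have cev : continuous ev.
  move=> c A cA; have /cvg_sup/(_ (existT _ x C)) : c --> c by exact: cvg_id.
  by apply; exact: (@initial_continuous _ _ ev).
have cev' : continuous (ev \o (set_val : coloring n X -> color_maps n X)).
  by move=> c; apply: continuous_comp; [exact: initial_continuous|exact: cev].
have -> : [set c : coloring n X | color (set_val c) C = i] =
    (ev \o set_val) @^-1` [set i] by [].
by apply: open_comp => [c _|]; [exact: cev'|exact: discrete_open].
Qed.

Lemma has_color_open (x : branch X) (y : X) (i : colors n) :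
  open [set c : coloring n X | has_color (set_val c) x y i].
Proof.
have -> : [set c : coloring n X | has_color (set_val c) x y i] =
    \bigcup_(C in [set C : components_at (set_val x) | set_val C y])
      [set c : coloring n X | color (set_val c) C = i].
  by apply/seteqP; split => c [C]; [move=> [Cy e]; exists C|move=> Cy e; exists C].
by apply: bigcup_open => C _; exact: color_open.
Qed.

Lemma components_at_uniq (x : X) (C C' : components_at x) (y : X) :
  set_val C y -> set_val C' y -> C = C'.
Proof.
have [w _ wE] : components_at x (set_val C) := set_valP C.
have [w' _ wE'] : components_at x (set_val C') := set_valP C'.
move=> Cy C'y; apply: val_inj; change (set_val C = set_val C').
move: Cy C'y; rewrite -wE -wE' => Cy C'y.
apply: same_connected_component; apply: connected_component_trans Cy _.
exact: connected_component_sym.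
Qed.

Lemma components_at_cover (x y : X) : x <> y ->
  exists C : components_at x, set_val C y.
Proof.
move=> xy; have yx : (~` [set x]) y by move=> /= e; exact: xy.
have CP : components_at x (connected_component (~` [set x]) y) by exists y.
by exists (SigSub (mem_set CP)); exact: connected_component_refl.
Qed.

End Colorings.

(** * Genericity of kaleidoscopic colorings *)

Section Kaleidoscopic.
Variables (R : realType) (n : option nat) (X : topologicalType).
Hypothesis hX : wazewski_dendrite R n X.

Let dX : dendrite R X. Proof. by case: hX. Qed.

Let query : Type := ((branch X * branch X) * (colors n * colors n))%type.

Let query_code : exists e : query -> nat, injective e.
Proof.
have /countable_injP[code ci] := branch_countable dX.
exists (fun t => pickle ((code (set_val t.1.1), code (set_val t.1.2)),
                (set_val t.2.1, set_val t.2.2))).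
move=> [[x y] [i j]] [[x' y'] [i' j']] /(pcan_inj pickleK) [].
have cinj (u v : branch X) : code (set_val u) = code (set_val v) -> u = v.
  by move=> /ci e; apply: val_inj; apply: e; rewrite inE; exact: set_valP.
by move=> /cinj -> /cinj -> /val_inj -> /val_inj ->.
Qed.

Lemma kaleidoscopic_colorings_Gdelta : Gdelta (kaleidoscopic_colorings R n X).
Proof.
have [e ei] := query_code.
pose U (t : query) : set (coloring n X) :=
  \bigcup_(z in [set z : branch X |
      open_arc R (set_val t.1.1) (set_val t.1.2) (set_val z)])
    ([set c : coloring n X | has_color (set_val c) z (set_val t.1.1) t.2.1] `&`
     [set c : coloring n X | has_color (set_val c) z (set_val t.1.2) t.2.2]).
have oU t : open (U t).
  by apply: bigcup_open => z _; apply: openI; exact: has_color_open.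
(* An index that codes no query with distinct points and distinct colors contributes the whole
   space. *)
exists (fun m => [set c |
    forall t, e t = m -> t.1.1 <> t.1.2 -> t.2.1 <> t.2.2 -> U t c]).
  move=> m; have [[t [tm t1 t2]]|nt] :=
      pselect (exists t, [/\ e t = m, t.1.1 <> t.1.2 & t.2.1 <> t.2.2]).
    rewrite (_ : [set c | _] = U t) //; apply/seteqP; split => c; first exact.
    by move=> Uc t'; rewrite -tm => /ei ->.
  rewrite (_ : [set c | _] = setT); first exact: openT.
  by apply/seteqP; split => // c _ t tm t1 t2; exfalso; apply: nt; exists t.
apply/seteqP; split => c.
- move=> kc m _ [[x y] [i j]] /= _ xy ij.
  by have [z [xyz zx zy]] := kc x y xy i j ij; exists z.
- move=> H x y xy i j ij.
  have [z /= xyz [zx zy]] := H (e ((x, y), (i, j))) Logic.I ((x, y), (i, j)) erefl xy ij.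
  by exists z.
Qed.

(* A kaleidoscopic coloring is obtained by answering each query [(x, y, i, j)]
   at its own branch point of [(x, y)], away from the first [N] branch points. *)
Lemma kaleidoscopic_approximation (code : X -> nat) (c0 : coloring n X) (N : nat) :
    {in branch X &, injective code} ->
  exists2 c : coloring n X, kaleidoscopic R (set_val c) &
    forall (z : branch X) (C : components_at (set_val z)),
      (code (set_val z) < N)%N -> color (set_val c) C = color (set_val c0) C.
Proof.
move=> ci; have [e ei] := query_code.
pose good (t : query) := t.1.1 <> t.1.2 /\ t.2.1 <> t.2.2.
have /choice[dec decP] m : exists o : option query, forall t, e t = m -> o = Some t.
  have [[t tm]|nt] := pselect (exists t, e t = m).
    by exists (Some t) => t'; rewrite -tm => /ei ->.
  by exists None => t tm; exfalso; apply: nt; exists t.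
have /choice[pick pickP] (Lt : seq nat * query) : exists z : branch X, good Lt.2 ->
    open_arc R (set_val Lt.2.1.1) (set_val Lt.2.1.2) (set_val z) /\
    code (set_val z) \notin Lt.1.
  case: Lt => L t /=; have [[t1 _]|nt] := pselect (good t); last by exists t.1.1 => /nt.
  have [|z [tz Bz zL]] :=
      branch_in_open_arc L (x := set_val t.1.1) (y := set_val t.1.2) hX ci.
    by move=> /val_inj.
  by exists (SigSub (mem_set Bz)).
(* [hist m] lists the reserved codes below [N] and those of the points picked for queries coded
   below [m]; each proper query picks a point outside its list. *)
pose hist := fix hist m := if m is m'.+1 then
  (if dec m' is Some t then code (set_val (pick (hist m', t))) :: hist m' else hist m')
  else iota 0 N.
pose zz t := pick (hist (e t), t).
have histS m k : (m <= k)%N -> {subset hist m <= hist k}.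
  move=> /subnK <-; elim: (k - m)%N => [//|i IH] w /IH wm.
  by rewrite addSn /=; case: (dec _) => // t; rewrite inE wm orbT.
have zzarc t : good t -> open_arc R (set_val t.1.1) (set_val t.1.2) (set_val (zz t)).
  by move=> gt; have [] := pickP (hist (e t), t) gt.
have zznew t m : good t -> (m <= e t)%N -> code (set_val (zz t)) \notin hist m.
  move=> gt mt; have [_] := pickP (hist (e t), t) gt.
  by apply: contra; exact: histS.
have zzold t : code (set_val (zz t)) \in hist (e t).+1.
  by rewrite /= (decP _ t erefl) inE eqxx.
have zzinj t t' : good t -> good t' -> zz t = zz t' -> t = t'.
  move=> gt gt' E; apply: ei; have [lt|gt_|//] := ltngtP (e t) (e t').
    by have := zzold t; rewrite E (negbTE (zznew _ _ gt' lt)).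
  by have := zzold t'; rewrite -E (negbTE (zznew _ _ gt gt_)).
have zzN t : good t -> (N <= code (set_val (zz t)))%N.
  move=> gt; have := zznew t 0%N gt (leq0n _).
  by rewrite /= mem_iota add0n /= -leqNgt.
have bij0 := set_valP c0.
(* A point serves at most one proper query, by [zzinj], so one permutation of the colors at [z]
   suffices; it is the identity if [z] serves none. *)
have /choice[s sP] (z : branch X) : exists s : colors n -> colors n,
    [/\ bijective s, (code (set_val z) < N)%N -> s = id
      & forall t, good t -> zz t = z -> forall Cx Cy : components_at (set_val z),
          set_val Cx (set_val t.1.1) -> set_val Cy (set_val t.1.2) ->
          s (color (set_val c0) Cx) = t.2.1 /\ s (color (set_val c0) Cy) = t.2.2].
  have [[t [gt tz]]|nt] := pselect (exists t, good t /\ zz t = z); last first.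
    exists id; split => //; first by exists id.
    by move=> t gt tz; exfalso; apply: nt; exists t.
  have tarc := zzarc t gt; rewrite tz in tarc.
  have [nxz nyz] := open_arc_neq tarc.
  have [Cx Cxx] := components_at_cover (fun h => nxz (esym h)).
  have [Cy Cyy] := components_at_cover (fun h => nyz (esym h)).
  (* As [z] separates the two query points, their old colors at [z] differ and can be sent to the
     prescribed pair. *)
  have CxCy : Cx <> Cy.
    move=> E; apply: (open_arc_separates dX tarc).
    have [w _ wE] : components_at _ (set_val Cx) := set_valP Cx.
    move: Cxx; rewrite E in wE *; rewrite -wE in Cyy * => Cxx.
    apply: connected_component_trans Cyy; exact: connected_component_sym.
  have cxy : color (set_val c0) Cx <> color (set_val c0) Cy by move=> /(bij_inj (bij0 z)).
  have [s [bs sx sy]] := exists_bijection2 cxy gt.2.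
  exists s; split => //.
    by rewrite -tz ltnNge zzN.
  move=> t' gt' t'z Cx' Cy'; have -> : t' = t by apply: zzinj; rewrite ?t'z ?tz.
  by move=> h1 h2; rewrite (components_at_uniq h1 Cxx) (components_at_uniq h2 Cyy).
pose c' : color_maps n X := fun bc => s (projT1 bc) (set_val c0 bc).
have cP : is_coloring n X c'.
  move=> z; have [bs _ _] := sP z.
  exact: (bij_comp bs (bij0 z)).
exists (SigSub (mem_set cP)); last first.
  move=> z C zN; have [_ /(_ zN) sz _] := sP z.
  by change (s z (color (set_val c0) C) = color (set_val c0) C); rewrite sz.
move=> x y xy i j ij; pose t : query := ((x, y), (i, j)).
have gt : good t by [].
have tarc := zzarc t gt; have [nxz nyz] := open_arc_neq tarc.
have [Cx Cxx] := components_at_cover (fun h => nxz (esym h)).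
have [Cy Cyy] := components_at_cover (fun h => nyz (esym h)).
have [_ _ sz] := sP (zz t); have [sx sy] := sz t gt erefl Cx Cy Cxx Cyy.
by exists (zz t); split => //; [exists Cx|exists Cy].
Qed.

(** The approximations converge to [c0] in the product topology: the coordinates at [z] agree with
    those of [c0] once [N] exceeds the code of [z]. *)
Lemma kaleidoscopic_colorings_dense : dense (kaleidoscopic_colorings R n X).
Proof.
move=> O [c0 Oc0] oO.
have /countable_injP[code ci] := branch_countable dX.
have /choice[c cP] N : exists c : coloring n X, kaleidoscopic R (set_val c) /\
    forall (z : branch X) (C : components_at (set_val z)),
      (code (set_val z) < N)%N -> color (set_val c) C = color (set_val c0) C.
  by have [c kc cc] := kaleidoscopic_approximation c0 N ci; exists c.
move: oO => [V oV OE].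
have Vc0 : V (set_val c0) by rewrite -OE in Oc0.
suff cv : (fun N => set_val (c N) : color_maps n X) @ \oo -->
    (set_val c0 : color_maps n X).
  have [N _ NO] := cv _ (open_nbhs_nbhs (conj oV Vc0)).
  exists (c N); split; last exact: (cP N).1.
  by rewrite -OE; exact: (NO N (leqnn _)).
apply/cvg_sup => -[z C] B [W [[A oA <-] /= Ac0] AB].
exists (code (set_val z)).+1 => // N /= zN; apply: AB => /=.
have := (cP N).2 z C zN; rewrite /color => ->.
exact: Ac0.
Qed.

End Kaleidoscopic.

Theorem proposition3p3 (R : realType) (n : option nat) (hn : three_le n)
    (D : topologicalType) (hD : wazewski_dendrite R n D) :
  Gdelta (kaleidoscopic_colorings R n D) /\
  dense (kaleidoscopic_colorings R n D).
Proof.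
by split; [exact: kaleidoscopic_colorings_Gdelta|exact: kaleidoscopic_colorings_dense].
Qed.
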